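(* Let $V$ be the potential of a natural Hamiltonian $H=\frac12(p_x^2+p_y^2)+V(x,y)$ on the cotangent bundle of the Euclidean plane $\mathbb{E}^2$, and suppose that $V$ is compatible with a pair of Killing two-tensors $(K_1,K_2)\in P=\mathcal{K}^2(\mathbb{E}^2)\times\mathcal{K}^2(\mathbb{E}^2)$, i.e. $\mathrm{d}(\hat K_1\,\mathrm{d}V)=0$ and $\mathrm{d}(\hat K_2\,\mathrm{d}V)=0$. Then the following statements are equivalent: (1) The pair $(K_1,K_2)\in P$ is characterized by the invariant conditions $$\Delta'_1\neq 0,\quad \Delta'_3=0,\quad \Delta'_4\neq 0,\quad \Delta'_6\neq 0,\quad \Delta'_7=\Delta'_8=\Delta'_9 .$$ (2) Up to the action of the isometry group $SE(2)$, the potential $V$ is the Smorodinsky-Winternitz potential $$V(x,y)=-\omega(x^2+y^2)+\frac{\alpha}{x^2}+\frac{\beta}{y^2},$$ where $\omega,\alpha,\beta$ are arbitrary real parameters.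
   Context: $(x,y)$ are Cartesian coordinates on the Euclidean plane $\mathbb{E}^2$ with Euclidean metric $g$, and $(p_x,p_y)$ are the conjugate momenta. $\mathcal{K}^2(\mathbb{E}^2)$ is the $6$-dimensional vector space of Killing two-tensors of $\mathbb{E}^2$ (symmetric contravariant two-tensors $K$ with vanishing Schouten bracket $[K,g]=0$). Its general element has components $$K^{11}=\beta_1+2\beta_4y+\beta_6y^2,\qquad K^{12}=K^{21}=\beta_3-\beta_4x-\beta_5y-\beta_6xy,\qquad K^{22}=\beta_2+2\beta_5x+\beta_6x^2,$$ with real parameters $\beta_1,\dots,\beta_6$. For a Killing two-tensor $K$, $\hat K=Kg^{-1}$ is the associated $(1,1)$-tensor obtained by using the metric, and $\mathrm{d}(\hat K\,\mathrm{d}V)=0$ is the compatibility (Bertrand-Darboux) condition, under which $K^{ij}p_ip_j+U$ is a first integral of $H$ for a suitable function $U$. For a pair $(K_1,K_2)\in P$, denote by $\alpha_1,\dots,\alpha_6$ the parameters of the first tensor $K_1$ (i.e. $K_1$ is given by the formulas above with each $\beta_i$ replaced by $\alpha_i$) and by $\beta_1,\dots,\beta_6$ the parameters of the second tensor $K_2$. The unsubscripted $\alpha,\beta$ in the potential are unrelated to these parameters. The group $SE(2)$ of orientation-preserving isometries acts on $\mathbb{E}^2$ and, by the induced action on tensors, on $P$. The singular points (foci) of a Killing two-tensor are the points of $\mathbb{E}^2$ at which its two eigenvalues coincide. Let $S_1,S_2$ be the foci of $K_2$ (the tensor with parameters $\beta_i$) and $S_3,S_4$ the foci of $K_1$ (the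 tensor with parameters $\alpha_i$), where two foci are allowed to coincide; in particular, $S_3=S_4$ when $\alpha_6\neq0$ and $\Delta'_3=0$. Let $d$ denote Euclidean distance. The joint invariants of the $SE(2)$-action on $P$ used in the claim are $$\Delta'_1=\alpha_6,\qquad \Delta'_3=\big(\alpha_6(\alpha_1-\alpha_2)-\alpha_4^2+\alpha_5^2\big)^2+4(\alpha_6\alpha_3+\alpha_4\alpha_5)^2,$$ $$\Delta'_4=\beta_6,\qquad \Delta'_6=\big(\beta_6(\beta_1-\beta_2)-\beta_4^2+\beta_5^2\big)^2+4(\beta_6\beta_3+\beta_4\beta_5)^2,$$ $$\Delta'_7=d^2(S_2,S_3),\qquad \Delta'_8=d^2(S_1,S_3),\qquad \Delta'_9=d^2(S_2,S_4).$$
   Formalization: Statement (1) is read as: V is compatible with some pair satisfying the conditions (for a fixed pair, V=0 with K1=K2=g refutes (2)⇒(1)); V in (2) is taken up to an additive constant (V=1 is compatible with every pair); V is smooth on a connected open domain. *)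

(* Defs.v *)
(* Stdlib reals with Coquelicot. *)
From Stdlib Require Export Reals.
From Coquelicot Require Export Coquelicot.
Open Scope R_scope.

Definition point : Type := (R * R)%type.

Definition dist2 (p q : point) : R :=
  (fst p - fst q) ^ 2 + (snd p - snd q) ^ 2.

Definition connected_set (D : point -> Prop) : Prop :=
  forall A B : point -> Prop,
    open A -> open B ->
    (forall p, D p -> A p \/ B p) ->
    (exists p, D p /\ A p) -> (exists p, D p /\ B p) ->
    exists p, D p /\ A p /\ B p.

Definition dx (f : R -> R -> R) (x y : R) : R := Derive (fun t => f t y) x.
Definition dy (f : R -> R -> R) (x y : R) : R := Derive (fun t => f x t) y.

(* [ex_diff_n f n x y]: the iterated partial derivatives of [f] of order at
   most [n] exist and are continuous at [(x, y)].  Nothing is required of [f]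
   outside the open set [D]. *)
Definition smooth_on (D : point -> Prop) (f : R -> R -> R) : Prop :=
  forall x y, D (x, y) -> forall n : nat, ex_diff_n f n x y.

(* A symmetric contravariant two-tensor field, by its Cartesian components. *)
Record sym_tensor : Type := SymTensor {
  K11 : R -> R -> R;
  K12 : R -> R -> R;
  K22 : R -> R -> R
}.

Definition metric : sym_tensor :=
  SymTensor (fun _ _ => 1) (fun _ _ => 0) (fun _ _ => 1).

(* The fibrewise quadratic function K^{ij} p_i p_j on the cotangent bundle,
   with momenta [p] = p_x and [q] = p_y. *)
Definition symbol (K : sym_tensor) (x y p q : R) : R :=
  K11 K x y * p ^ 2 + 2 * K12 K x y * p * q + K22 K x y * q ^ 2.

(* Under the identification [symbol], the Schouten bracket of symmetric
   contravariant tensors is the canonical Poisson bracket (up to the choice of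
   an overall nonzero constant, immaterial for its vanishing). *)
Definition schouten (K L : sym_tensor) (x y p q : R) : R :=
  Derive (fun t => symbol K t y p q) x * Derive (fun t => symbol L x y t q) p
  - Derive (fun t => symbol K x y t q) p * Derive (fun t => symbol L t y p q) x
  + Derive (fun t => symbol K x t p q) y * Derive (fun t => symbol L x y p t) q
  - Derive (fun t => symbol K x y p t) q * Derive (fun t => symbol L x t p q) y.

Definition killing (K : sym_tensor) : Prop :=
  smooth_on (fun _ => True) (K11 K) /\
  smooth_on (fun _ => True) (K12 K) /\
  smooth_on (fun _ => True) (K22 K) /\
  forall x y p q, schouten K metric x y p q = 0.

Record killing_params : Type := KillingParams {
  b1 : R; b2 : R; b3 : R; b4 : R; b5 : R; b6 : R
}.

Definition has_params (K : sym_tensor) (b : killing_params) : Prop :=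
  forall x y,
    K11 K x y = b1 b + 2 * b4 b * y + b6 b * y ^ 2 /\
    K12 K x y = b3 b - b4 b * x - b5 b * y - b6 b * x * y /\
    K22 K x y = b2 b + 2 * b5 b * x + b6 b * x ^ 2.

(* [l] is an eigenvalue of the (1,1)-tensor K g^{-1} at [s]; in Cartesian
   coordinates its matrix is that of the components of [K]. *)
Definition eigenvalue (K : sym_tensor) (s : point) (l : R) : Prop :=
  let (x, y) := s in
  exists u v : R, ~ (u = 0 /\ v = 0) /\
    K11 K x y * u + K12 K x y * v = l * u /\
    K12 K x y * u + K22 K x y * v = l * v.

(* The matrix is real symmetric of size two, so it is diagonalizable over the
   reals: its two eigenvalues coincide iff it has only one eigenvalue. *)
Definition singular_point (K : sym_tensor) (s : point) : Prop :=
  forall l m : R, eigenvalue K s l -> eigenvalue K s m -> l = m.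

(* [S] and [S'] enumerate the foci of [K]; they may coincide. *)
Definition foci (K : sym_tensor) (S S' : point) : Prop :=
  forall s : point, singular_point K s <-> s = S \/ s = S'.

(* d(K^ dV) = 0 on [D], where K^ dV is the one-form with components
   (K11 V_x + K12 V_y, K12 V_x + K22 V_y). *)
Definition compatible (D : point -> Prop) (K : sym_tensor) (V : R -> R -> R) :
    Prop :=
  forall x y, D (x, y) ->
    dx (fun s t => K12 K s t * dx V s t + K22 K s t * dy V s t) x y
    - dy (fun s t => K11 K s t * dx V s t + K12 K s t * dy V s t) x y = 0.

(* Delta'_3 at the parameters of the first tensor, Delta'_6 at those of the
   second. *)
Definition focal_invariant (b : killing_params) : R :=
  (b6 b * (b1 b - b2 b) - b4 b ^ 2 + b5 b ^ 2) ^ 2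
  + 4 * (b6 b * b3 b + b4 b * b5 b) ^ 2.

(* The labelling of each pair of foci is irrelevant: [focal_invariant a = 0]
   and [b6 a <> 0] force S3 = S4, and then exchanging S1 and S2 only permutes
   the three equal distances. *)
Definition invariant_conditions (K1 K2 : sym_tensor) : Prop :=
  exists (a b : killing_params) (S1 S2 S3 S4 : point),
    has_params K1 a /\ has_params K2 b /\
    foci K2 S1 S2 /\ foci K1 S3 S4 /\
    b6 a <> 0 /\
    focal_invariant a = 0 /\
    b6 b <> 0 /\
    focal_invariant b <> 0 /\
    dist2 S2 S3 = dist2 S1 S3 /\
    dist2 S1 S3 = dist2 S2 S4.

(* The elements of SE(2): rotation by [theta] followed by translation. *)
Definition rigid_motion (theta a b : R) (s : point) : point :=
  (cos theta * fst s - sin theta * snd s + a,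
   sin theta * fst s + cos theta * snd s + b).

Definition smorodinsky_winternitz (omega alpha beta x y : R) : R :=
  - omega * (x ^ 2 + y ^ 2) + alpha / x ^ 2 + beta / y ^ 2.

(* Potentials are taken modulo additive constants.  In the moved coordinates,
   [D] must avoid the axis on which a term with nonzero coefficient is
   singular; a term with coefficient 0 is 0 everywhere, as 0 / 0 = 0 * / 0. *)
Definition is_smorodinsky_winternitz (D : point -> Prop) (V : R -> R -> R) :
    Prop :=
  exists theta a b omega alpha beta c : R,
    forall x y : R,
      let s := rigid_motion theta a b (x, y) in
      D s ->
      (alpha <> 0 -> x <> 0) /\ (beta <> 0 -> y <> 0) /\
      V (fst s) (snd s) = smorodinsky_winternitz omega alpha beta x y + c.

(* Main.v *)
(* Everything is computed with the derivations X and Y along an orthonormal frame and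
   the Cartesian coordinates xi, eta of that frame.

   A Killing tensor with b6 <> 0 is b6 (L_m^2 + (v.p)^2) modulo the metric, where L_m is
   the angular momentum about the midpoint m of the foci m + v and m - v.  The invariant
   conditions say that K1 is L_S^2 with S = S3 = S4, and that S lies on the bisector
   of the foci of K2, so m = S + h Y in the frame at S with X parallel to v.

   If h = 0, the difference of K2 and K1 is p_X^2, so XYV = 0, and the equation of L_S^2
   then forces the potential: the derivatives that isolate omega, alpha, beta and the
   additive constant have zero gradient, hence are constant on the connected set D.

   The bisector condition alone allows h <> 0.  Then the difference is parabolic,
   L p_X + k p_X^2 with k <> 0, and together with the equation of L_S^2 it is
   an overdetermined system for u = YV which yields k^2 xi u = 0.  So YV = 0,
   in particular XYV = 0, and the first case applies. *)
Require Import Defs.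
From Stdlib Require Import Lra Psatz.

(** * Calculus of smooth functions on an open set *)

Lemma open_locally_2d (D : point -> Prop) (x y : R) :
  open D -> D (x, y) -> locally_2d (fun u v => D (u, v)) x y.
Proof.
  intros HD Hxy. apply locally_2d_locally.
  generalize (HD (x, y) Hxy). apply filter_imp. now intros [u v].
Qed.

Lemma open_locally_x (D : point -> Prop) (x y : R) :
  open D -> D (x, y) -> locally x (fun t => D (t, y)).
Proof.
  intros HD Hxy.
  exact (locally_2d_1d_const_y _ _ _ (open_locally_2d D x y HD Hxy)).
Qed.

Lemma open_locally_y (D : point -> Prop) (x y : R) :
  open D -> D (x, y) -> locally y (fun t => D (x, t)).
Proof.
  intros HD Hxy.
  exact (locally_2d_1d_const_x _ _ _ (open_locally_2d D x y HD Hxy)).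
Qed.

Lemma smooth_continuous D f x y :
  smooth_on D f -> D (x, y) -> continuity_2d_pt f x y.
Proof. intros Hf Hxy. apply (Hf x y Hxy 0%nat). Qed.

Lemma smooth_ex_derive_x D f x y :
  smooth_on D f -> D (x, y) -> ex_derive (fun t => f t y) x.
Proof. intros Hf Hxy. apply (Hf x y Hxy 1%nat). Qed.

Lemma smooth_ex_derive_y D f x y :
  smooth_on D f -> D (x, y) -> ex_derive (fun t => f x t) y.
Proof. intros Hf Hxy. apply (Hf x y Hxy 1%nat). Qed.

Lemma smooth_dx D f : smooth_on D f -> smooth_on D (dx f).
Proof. intros Hf x y Hxy n. apply (Hf x y Hxy (S n)). Qed.

Lemma smooth_dy D f : smooth_on D f -> smooth_on D (dy f).
Proof. intros Hf x y Hxy n. apply (Hf x y Hxy (S n)). Qed.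

Lemma dx_dy_comm D f x y :
  open D -> smooth_on D f -> D (x, y) -> dx (dy f) x y = dy (dx f) x y.
Proof.
  intros HD Hf Hxy. unfold dx, dy. apply Schwarz.
  - generalize (open_locally_2d D x y HD Hxy).
    apply locally_2d_impl, locally_2d_forall. intros u v Huv. repeat split.
    + exact (smooth_ex_derive_x D f u v Hf Huv).
    + exact (smooth_ex_derive_y D f u v Hf Huv).
    + exact (smooth_ex_derive_x D _ u v (smooth_dy D f Hf) Huv).
    + exact (smooth_ex_derive_y D _ u v (smooth_dx D f Hf) Huv).
  - exact (smooth_continuous D _ x y (smooth_dx D _ (smooth_dy D f Hf)) Hxy).
  - exact (smooth_continuous D _ x y (smooth_dy D _ (smooth_dx D f Hf)) Hxy).
Qed.

(** Induction on the order. The hypotheses range over all of [D] because the recursion passes to the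
    partial derivatives, which are known to be additive only at points of [D]; openness turns this
    into agreement near each point. *)
Lemma ex_diff_n_plus D : open D -> forall n f g,
  (forall x y, D (x, y) -> ex_diff_n f n x y) ->
  (forall x y, D (x, y) -> ex_diff_n g n x y) ->
  forall x y, D (x, y) -> ex_diff_n (fun u v => f u v + g u v) n x y.
Proof.
  intros HD. induction n as [|n IH]; intros f g Hf Hg x y Hxy.
  - split; [|exact I].
    apply (continuity_2d_pt_plus f g); [apply Hf | apply Hg]; exact Hxy.
  - destruct (Hf x y Hxy) as (Cf & f1 & f2 & _).
    destruct (Hg x y Hxy) as (Cg & g1 & g2 & _).
    repeat split.
    + now apply (continuity_2d_pt_plus f g).
    + now apply (ex_derive_plus (fun z => f z y) (fun z => g z y)).
    + now apply (ex_derive_plus (fun z => f x z) (fun z => g x z)).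
    + apply (ex_diff_n_ext_loc (fun u v => dx f u v + dx g u v)).
      * generalize (open_locally_2d D x y HD Hxy).
        apply locally_2d_impl, locally_2d_forall. intros u v Huv. unfold dx.
        symmetry. apply (Derive_plus (fun z => f z v) (fun z => g z v));
          [apply (Hf u v Huv) | apply (Hg u v Huv)].
      * apply IH; trivial; intros u v Huv; [apply (Hf u v Huv) | apply (Hg u v Huv)].
    + apply (ex_diff_n_ext_loc (fun u v => dy f u v + dy g u v)).
      * generalize (open_locally_2d D x y HD Hxy).
        apply locally_2d_impl, locally_2d_forall. intros u v Huv. unfold dy.
        symmetry. apply (Derive_plus (fun z => f u z) (fun z => g u z));
          [apply (Hf u v Huv) | apply (Hg u v Huv)].
      * apply IH; trivial; intros u v Huv; [apply (Hf u v Huv) | apply (Hg u v Huv)].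
Qed.

(** By the Leibniz rule each partial derivative is a sum of two products, to which the induction
    hypothesis and the sum rule apply. *)
Lemma ex_diff_n_mult D : open D -> forall n f g,
  (forall x y, D (x, y) -> ex_diff_n f n x y) ->
  (forall x y, D (x, y) -> ex_diff_n g n x y) ->
  forall x y, D (x, y) -> ex_diff_n (fun u v => f u v * g u v) n x y.
Proof.
  intros HD. induction n as [|n IH]; intros f g Hf Hg x y Hxy.
  - split; [|exact I].
    apply (continuity_2d_pt_mult f g); [apply Hf | apply Hg]; exact Hxy.
  - destruct (Hf x y Hxy) as (Cf & f1 & f2 & _).
    destruct (Hg x y Hxy) as (Cg & g1 & g2 & _).
    (* The Leibniz rule keeps one factor undifferentiated, so its order is lowered from [S n] to
       [n]. *)
    assert (Lf : forall u v, D (u, v) -> ex_diff_n f n u v)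
      by (intros u v Huv; apply (ex_diff_n_m (S n)); auto).
    assert (Lg : forall u v, D (u, v) -> ex_diff_n g n u v)
      by (intros u v Huv; apply (ex_diff_n_m (S n)); auto).
    repeat split.
    + now apply (continuity_2d_pt_mult f g).
    + now apply (ex_derive_mult (fun z => f z y) (fun z => g z y)).
    + now apply (ex_derive_mult (fun z => f x z) (fun z => g x z)).
    + apply (ex_diff_n_ext_loc
        (fun u v => dx f u v * g u v + f u v * dx g u v)).
      * generalize (open_locally_2d D x y HD Hxy).
        apply locally_2d_impl, locally_2d_forall. intros u v Huv. unfold dx.
        symmetry. apply (Derive_mult (fun z => f z v) (fun z => g z v));
          [apply (Hf u v Huv) | apply (Hg u v Huv)].
      * apply (ex_diff_n_plus D HD n (fun u v => dx f u v * g u v)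
          (fun u v => f u v * dx g u v)); trivial;
          apply IH; trivial; intros u v Huv; [apply (Hf u v Huv) | apply (Hg u v Huv)].
    + apply (ex_diff_n_ext_loc
        (fun u v => dy f u v * g u v + f u v * dy g u v)).
      * generalize (open_locally_2d D x y HD Hxy).
        apply locally_2d_impl, locally_2d_forall. intros u v Huv. unfold dy.
        symmetry. apply (Derive_mult (fun z => f u z) (fun z => g u z));
          [apply (Hf u v Huv) | apply (Hg u v Huv)].
      * apply (ex_diff_n_plus D HD n (fun u v => dy f u v * g u v)
          (fun u v => f u v * dy g u v)); trivial;
          apply IH; trivial; intros u v Huv; [apply (Hf u v Huv) | apply (Hg u v Huv)].
Qed.

Lemma smooth_const D k : smooth_on D (fun _ _ => k).
Proof.
  intros x y Hxy n. clear Hxy. revert k x y.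
  induction n as [|n IH]; intros k x y; repeat split;
    try apply continuity_2d_pt_const; try apply ex_derive_const.
  - apply (ex_diff_n_ext_loc (fun _ _ => 0)); [|apply IH].
    apply locally_2d_forall. intros u v. symmetry. apply Derive_const.
  - apply (ex_diff_n_ext_loc (fun _ _ => 0)); [|apply IH].
    apply locally_2d_forall. intros u v. symmetry. apply Derive_const.
Qed.

Lemma smooth_fst D : smooth_on D (fun x _ => x).
Proof.
  intros x y Hxy n. destruct n as [|n].
  { split; [apply continuity_2d_pt_id1 | exact I]. }
  refine (conj _ (conj _ (conj _ (conj _ _)))).
  - apply continuity_2d_pt_id1.
  - apply @ex_derive_id.
  - apply @ex_derive_const.
  - apply (ex_diff_n_ext_loc (fun _ _ => 1)).
    + apply locally_2d_forall. intros u v. symmetry. apply Derive_id.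
    + now apply (smooth_const D 1).
  - apply (ex_diff_n_ext_loc (fun _ _ => 0)).
    + apply locally_2d_forall. intros u v. symmetry. apply Derive_const.
    + now apply (smooth_const D 0).
Qed.

Lemma smooth_snd D : smooth_on D (fun _ y => y).
Proof.
  intros x y Hxy n. destruct n as [|n].
  { split; [apply continuity_2d_pt_id2 | exact I]. }
  refine (conj _ (conj _ (conj _ (conj _ _)))).
  - apply continuity_2d_pt_id2.
  - apply @ex_derive_const.
  - apply @ex_derive_id.
  - apply (ex_diff_n_ext_loc (fun _ _ => 0)).
    + apply locally_2d_forall. intros u v. symmetry. apply Derive_const.
    + now apply (smooth_const D 0).
  - apply (ex_diff_n_ext_loc (fun _ _ => 1)).
    + apply locally_2d_forall. intros u v. symmetry. apply Derive_id.
    + now apply (smooth_const D 1).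
Qed.

Lemma smooth_plus D f g : open D ->
  smooth_on D f -> smooth_on D g -> smooth_on D (fun x y => f x y + g x y).
Proof.
  intros HD Hf Hg x y Hxy n.
  apply (ex_diff_n_plus D HD n f g); auto.
Qed.

Lemma smooth_mult D f g : open D ->
  smooth_on D f -> smooth_on D g -> smooth_on D (fun x y => f x y * g x y).
Proof.
  intros HD Hf Hg x y Hxy n.
  apply (ex_diff_n_mult D HD n f g); auto.
Qed.

(** * Directional derivatives *)

Definition dir (c s : R) (f : R -> R -> R) (x y : R) : R :=
  c * dx f x y + s * dy f x y.

(** Unlike [dir], which inherits the totality of [Derive], this relation asserts that both partial
    derivatives exist, so its rules chain without side conditions. *)
Definition is_dir (c s : R) (f : R -> R -> R) (x y l : R) : Prop :=
  exists l1 l2 : R,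
    is_derive (fun t => f t y) x l1 /\ is_derive (fun t => f x t) y l2 /\
    c * l1 + s * l2 = l.

Lemma is_dir_unique c s f x y l : is_dir c s f x y l -> dir c s f x y = l.
Proof.
  intros (l1 & l2 & H1 & H2 & <-). unfold dir, dx, dy.
  f_equal; f_equal; now apply is_derive_unique.
Qed.

Lemma is_dir_ext_on D c s (f g : R -> R -> R) (x y l : R) : open D -> D (x, y) ->
  (forall u v, D (u, v) -> f u v = g u v) ->
  is_dir c s f x y l -> is_dir c s g x y l.
Proof.
  intros HD Hxy E (l1 & l2 & H1 & H2 & H). exists l1, l2. refine (conj _ (conj _ H)).
  - refine (is_derive_ext_loc (fun t => f t y) (fun t => g t y) x l1 _ H1).
    generalize (open_locally_x D x y HD Hxy). apply filter_imp. auto.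
  - refine (is_derive_ext_loc (fun t => f x t) (fun t => g x t) y l2 _ H2).
    generalize (open_locally_y D x y HD Hxy). apply filter_imp. auto.
Qed.

Lemma dir_ext_on D c s (f g : R -> R -> R) (x y : R) : open D -> D (x, y) ->
  (forall u v, D (u, v) -> f u v = g u v) -> dir c s f x y = dir c s g x y.
Proof.
  intros HD Hxy E. unfold dir, dx, dy. f_equal; f_equal; apply Derive_ext_loc.
  - generalize (open_locally_x D x y HD Hxy). apply filter_imp. auto.
  - generalize (open_locally_y D x y HD Hxy). apply filter_imp. auto.
Qed.

Lemma is_dir_const c s k x y : is_dir c s (fun _ _ => k) x y 0.
Proof.
  exists 0, 0. refine (conj _ (conj _ _)); [apply @is_derive_const | apply @is_derive_const | ring].
Qed.

Lemma dir_zero_on D c s (f : R -> R -> R) (x y : R) : open D -> D (x, y) ->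
  (forall u v, D (u, v) -> f u v = 0) -> dir c s f x y = 0.
Proof.
  intros HD Hxy E. rewrite (dir_ext_on D c s f (fun _ _ => 0) x y HD Hxy E).
  apply is_dir_unique, is_dir_const.
Qed.

Lemma is_dir_zero_on D c s (f : R -> R -> R) (x y l : R) : open D -> D (x, y) ->
  (forall u v, D (u, v) -> f u v = 0) -> is_dir c s f x y l -> l = 0.
Proof.
  intros HD Hxy E H. rewrite <- (is_dir_unique _ _ _ _ _ _ H).
  exact (dir_zero_on D c s f x y HD Hxy E).
Qed.

Lemma is_dir_plus c s f g x y l m :
  is_dir c s f x y l -> is_dir c s g x y m ->
  is_dir c s (fun u v => f u v + g u v) x y (l + m).
Proof.
  intros (l1 & l2 & H1 & H2 & <-) (m1 & m2 & G1 & G2 & <-).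
  exists (l1 + m1), (l2 + m2). refine (conj _ (conj _ _)); [| |ring].
  - exact (is_derive_plus _ _ _ _ _ H1 G1).
  - exact (is_derive_plus _ _ _ _ _ H2 G2).
Qed.

Lemma is_dir_minus c s f g x y l m :
  is_dir c s f x y l -> is_dir c s g x y m ->
  is_dir c s (fun u v => f u v - g u v) x y (l - m).
Proof.
  intros (l1 & l2 & H1 & H2 & <-) (m1 & m2 & G1 & G2 & <-).
  exists (l1 - m1), (l2 - m2). refine (conj _ (conj _ _)); [| |ring].
  - exact (is_derive_minus _ _ _ _ _ H1 G1).
  - exact (is_derive_minus _ _ _ _ _ H2 G2).
Qed.

Lemma is_dir_mult c s f g x y l m :
  is_dir c s f x y l -> is_dir c s g x y m ->
  is_dir c s (fun u v => f u v * g u v) x y (l * g x y + f x y * m).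
Proof.
  intros (l1 & l2 & H1 & H2 & <-) (m1 & m2 & G1 & G2 & <-).
  exists (l1 * g x y + f x y * m1), (l2 * g x y + f x y * m2).
  refine (conj _ (conj _ _)); [| |ring].
  - exact (is_derive_mult _ _ _ _ _ H1 G1 Rmult_comm).
  - exact (is_derive_mult _ _ _ _ _ H2 G2 Rmult_comm).
Qed.

Lemma is_dir_smooth D c s f x y :
  smooth_on D f -> D (x, y) -> is_dir c s f x y (dir c s f x y).
Proof.
  intros Hf Hxy. exists (dx f x y), (dy f x y). refine (conj _ (conj _ eq_refl)).
  - apply Derive_correct. exact (smooth_ex_derive_x D f x y Hf Hxy).
  - apply Derive_correct. exact (smooth_ex_derive_y D f x y Hf Hxy).
Qed.

Lemma smooth_dir D c s f : open D -> smooth_on D f -> smooth_on D (dir c s f).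
Proof.
  intros HD Hf.
  apply (smooth_plus D (fun x y => c * dx f x y) (fun x y => s * dy f x y) HD).
  - apply (smooth_mult D (fun _ _ => c)); trivial.
    apply smooth_const. now apply smooth_dx.
  - apply (smooth_mult D (fun _ _ => s)); trivial.
    apply smooth_const. now apply smooth_dy.
Qed.

(** Schwarz's theorem leaves three Cartesian second partials, so that identities between second
    derivatives along frames become polynomial identities in [c] and [s]. *)
Lemma dir_dir D c s c' s' f x y : open D -> smooth_on D f -> D (x, y) ->
  dir c s (dir c' s' f) x y =
  c * c' * dx (dx f) x y + (c * s' + s * c') * dy (dx f) x y
  + s * s' * dy (dy f) x y.
Proof.
  intros HD Hf Hxy.
  assert (H1 := smooth_dx D f Hf). assert (H2 := smooth_dy D f Hf).
  assert (E1 : dx (dir c' s' f) x y = c' * dx (dx f) x y + s' * dx (dy f) x y).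
  { unfold dir. unfold dx at 1.
    rewrite (Derive_plus (fun t => c' * dx f t y) (fun t => s' * dy f t y)).
    - now rewrite !Derive_scal.
    - apply (ex_derive_scal (fun t => dx f t y)).
      exact (smooth_ex_derive_x D _ x y H1 Hxy).
    - apply (ex_derive_scal (fun t => dy f t y)).
      exact (smooth_ex_derive_x D _ x y H2 Hxy). }
  assert (E2 : dy (dir c' s' f) x y = c' * dy (dx f) x y + s' * dy (dy f) x y).
  { unfold dir. unfold dy at 1.
    rewrite (Derive_plus (fun t => c' * dx f x t) (fun t => s' * dy f x t)).
    - now rewrite !Derive_scal.
    - apply (ex_derive_scal (fun t => dx f x t)).
      exact (smooth_ex_derive_y D _ x y H1 Hxy).
    - apply (ex_derive_scal (fun t => dy f x t)).
      exact (smooth_ex_derive_y D _ x y H2 Hxy). }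
  unfold dir at 1. rewrite E1, E2, (dx_dy_comm D f x y HD Hf Hxy). ring.
Qed.

Lemma dir_comm D c s c' s' f x y : open D -> smooth_on D f -> D (x, y) ->
  dir c s (dir c' s' f) x y = dir c' s' (dir c s f) x y.
Proof.
  intros HD Hf Hxy. rewrite !(dir_dir D) by assumption. ring.
Qed.

(** * Functions with zero gradient on a connected open set *)

Lemma Rabs_between_lt (u x t d : R) :
  Rabs (u - x) < d -> Rmin u x <= t <= Rmax u x -> Rabs (t - x) < d.
Proof.
  intros Hu Ht. apply Rabs_def2 in Hu. revert Ht. unfold Rmin, Rmax.
  destruct (Rle_dec u x); intros Ht; apply Rabs_def1; lra.
Qed.

(** Such a function is locally constant, so a level set and its complement in [D] are both open;
    connectedness forbids that both are nonempty. *)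
Lemma gradient_zero_const (D : point -> Prop) (f : R -> R -> R) :
  open D -> connected_set D ->
  (forall x y, D (x, y) ->
    is_derive (fun t => f t y) x 0 /\ is_derive (fun t => f x t) y 0) ->
  exists k, forall x y, D (x, y) -> f x y = k.
Proof.
  intros HD HC H.
  assert (Hseg : forall (g : R -> R) a b,
    (forall t, Rmin a b <= t <= Rmax a b -> is_derive g t 0) -> g a = g b).
  { intros g a b Hg. destruct (Rtotal_order a b) as [L|[->|L]]; trivial.
    - apply (eq_is_derive g); trivial. intros t Ht. apply Hg.
      rewrite Rmin_left, Rmax_right; lra.
    - symmetry. apply (eq_is_derive g); trivial. intros t Ht. apply Hg.
      rewrite Rmin_right, Rmax_left; lra. }
  (* In a square around [(x, y)] inside [D], the point [(u, v)] is joined to [(x, y)] by two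
     axis-parallel segments meeting at [(x, v)]. *)
  assert (Hloc : forall x y, D (x, y) ->
    locally_2d (fun u v => D (u, v) /\ f u v = f x y) x y).
  { intros x y Hxy. destruct (open_locally_2d D x y HD Hxy) as [d Hd].
    exists d. intros u v Hu Hv. split; [now apply Hd|].
    transitivity (f x v).
    - apply (Hseg (fun t => f t v)). intros t Ht.
      refine (proj1 (H t v (Hd t v _ Hv))). now apply (Rabs_between_lt u).
    - apply (Hseg (fun t => f x t)). intros t Ht.
      refine (proj2 (H x t (Hd x t _ _))).
      + rewrite Rminus_diag, Rabs_R0. apply cond_pos.
      + now apply (Rabs_between_lt v). }
  assert (Hopen : forall P : R -> Prop,
    open (fun p : point => D p /\ P (f (fst p) (snd p)))).
  { intros P [x y] [Hxy HP].
    generalize (proj1 (locally_2d_locally _ _ _) (Hloc x y Hxy)).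
    apply filter_imp. intros [u v]. simpl. intros [Huv ->]. now split. }
  destruct (Classical_Prop.classic (exists p, D p)) as [[[x0 y0] H0]|Hn].
  - exists (f x0 y0). intros x y Hxy.
    destruct (Req_dec (f x y) (f x0 y0)) as [E|E]; trivial. exfalso.
    destruct (HC _ _ (Hopen (fun z => z = f x0 y0)) (Hopen (fun z => z <> f x0 y0)))
      as (p & _ & (_ & E1) & (_ & E2)).
    + intros p Hp. destruct (Req_dec (f (fst p) (snd p)) (f x0 y0)); auto.
    + now exists (x0, y0).
    + now exists (x, y).
    + contradiction.
  - exists 0. intros x y Hxy. exfalso. eauto.
Qed.

(** * Linear coordinates of an orthonormal frame *)

(** For a unit vector [(c, s)], the functions [lin c s d] and [lin (- s) c e] are the coordinates xi
    and eta of the frame; the offsets [d] and [e] place its origin. *)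
Definition lin (c s d x y : R) : R := c * x + s * y + d.

Lemma is_dir_comp_lin a b c s d F x y l :
  is_derive F (lin c s d x y) l ->
  is_dir a b (fun u v => F (lin c s d u v)) x y ((a * c + b * s) * l).
Proof.
  intros HF. exists (c * l), (s * l). refine (conj _ (conj _ _)); [| |ring].
  - apply (is_derive_comp F (fun t => lin c s d t y)); trivial.
    unfold lin. auto_derive; trivial. ring.
  - apply (is_derive_comp F (fun t => lin c s d x t)); trivial.
    unfold lin. auto_derive; trivial. ring.
Qed.

Lemma is_dir_lin a b c s d x y : is_dir a b (lin c s d) x y (a * c + b * s).
Proof.
  rewrite <- (Rmult_1_r (a * c + b * s)).
  apply (is_dir_comp_lin a b c s d (fun t => t)).
  apply @is_derive_id.
Qed.

Lemma is_dir_fst c s x y : is_dir c s (fun u _ => u) x y c.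
Proof.
  exists 1, 0. refine (conj _ (conj _ _)); [| |ring].
  - apply @is_derive_id.
  - apply @is_derive_const.
Qed.

Lemma is_dir_snd c s x y : is_dir c s (fun _ v => v) x y s.
Proof.
  exists 0, 1. refine (conj _ (conj _ _)); [| |ring].
  - apply @is_derive_const.
  - apply @is_derive_id.
Qed.

Ltac solve_smooth :=
  repeat first [apply smooth_dx | apply smooth_dy
    | apply smooth_dir; [assumption|]]; assumption.

(** The value of the derivative may be an existential variable, which the rules fill in from the
    syntax of the function. For an atomic function, smoothness is derived from the context and the
    value is recorded with [dir]. *)
Ltac solve_is_dir :=
  lazymatch goal with
  | |- is_dir _ _ (fun _ _ => ?k) _ _ _ => apply is_dir_const
  | |- is_dir _ _ (fun u v => @?f u v + @?g u v) _ _ _ =>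
      eapply (is_dir_plus _ _ f g); solve_is_dir
  | |- is_dir _ _ (fun u v => @?f u v - @?g u v) _ _ _ =>
      eapply (is_dir_minus _ _ f g); solve_is_dir
  | |- is_dir _ _ (fun u v => @?f u v * @?g u v) _ _ _ =>
      eapply (is_dir_mult _ _ f g); solve_is_dir
  | |- is_dir _ _ (fun u v => lin ?c ?s ?d u v) _ _ _ =>
      apply (is_dir_lin _ _ c s d)
  | |- is_dir _ _ (fun u _ => u) _ _ _ => apply is_dir_fst
  | |- is_dir _ _ (fun _ v => v) _ _ _ => apply is_dir_snd
  | |- is_dir _ _ (fun u v => ?f u v) _ _ _ =>
      eapply (is_dir_smooth _ _ _ f); [|eassumption]; solve_smooth
  end.

(* [differentiate c s H at x y as G]: from [H : forall u v, D (u, v) -> P u v = 0]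
   and a point [(x, y)] of the open set [D], the derivative of [P] vanishes. *)
Tactic Notation "differentiate" constr(c) constr(s) constr(H) "at"
    constr(x) constr(y) "as" ident(G) :=
  lazymatch type of H with
  | forall u v, ?D (u, v) -> @?P u v = 0 =>
      eassert (G : is_dir c s P x y _) by solve_is_dir;
      apply (is_dir_zero_on D c s _ x y _ ltac:(assumption) ltac:(assumption) H) in G;
      cbv beta in G
  end.

(** The relation [c * c + s * s = 1] inverts the frame, so the two Cartesian partials vanish as
    well. *)
Lemma dir_zero_const D c s f :
  open D -> connected_set D -> c * c + s * s = 1 ->
  (forall x y, D (x, y) -> is_dir c s f x y 0 /\ is_dir (- s) c f x y 0) ->
  exists k, forall x y, D (x, y) -> f x y = k.
Proof.
  intros HD HC Hcs H. apply (gradient_zero_const D); trivial.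
  intros x y Hxy.
  destruct (H x y Hxy) as [(l1 & l2 & H1 & H2 & E) (m1 & m2 & G1 & G2 & F)].
  assert (m1 = l1) as ->
    by (rewrite <- (is_derive_unique _ _ _ H1); symmetry; now apply is_derive_unique).
  assert (m2 = l2) as ->
    by (rewrite <- (is_derive_unique _ _ _ H2); symmetry; now apply is_derive_unique).
  assert (E1 : l1 = 0).
  { rewrite <- (Rmult_1_l l1), <- Hcs.
    transitivity (c * (c * l1 + s * l2) - s * (- s * l1 + c * l2)); [ring|].
    rewrite E, F. ring. }
  assert (E2 : l2 = 0).
  { rewrite <- (Rmult_1_l l2), <- Hcs.
    transitivity (s * (c * l1 + s * l2) + c * (- s * l1 + c * l2)); [ring|].
    rewrite E, F. ring. }
  rewrite E1 in H1. rewrite E2 in H2.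
  now split.
Qed.

(* Differentiate the product across the line where the linear factor vanishes. *)
Lemma lin_factor_zero D c s d g :
  open D -> c * c + s * s = 1 ->
  (forall x y, D (x, y) -> lin c s d x y * g x y = 0) ->
  (forall x y, D (x, y) -> exists l, is_dir c s g x y l) ->
  forall x y, D (x, y) -> g x y = 0.
Proof.
  intros HD Hcs H Hg x y Hxy. destruct (Hg x y Hxy) as [l Hl].
  assert (E := is_dir_zero_on D _ _ _ x y _ HD Hxy H
                 (is_dir_mult _ _ _ _ _ _ _ _ (is_dir_lin c s c s d x y) Hl)).
  specialize (H x y Hxy). rewrite Hcs in E.
  destruct (Rmult_integral _ _ H) as [H0|H0]; trivial.
  rewrite H0 in E. lra.
Qed.

(** * One-variable parts of the Smorodinsky-Winternitz potential *)

Definition radial (omega alpha t : R) : R := - omega * t ^ 2 + alpha / t ^ 2.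

Definition radial' (omega alpha t : R) : R := - 2 * omega * t - 2 * alpha / t ^ 3.

(** For [alpha = 0] the quotient is identically zero, even at [t = 0], because division is total;
    that case is treated apart so that the domain may then meet the axis. *)
Lemma is_derive_radial omega alpha t : (alpha <> 0 -> t <> 0) ->
  is_derive (radial omega alpha) t (radial' omega alpha t).
Proof.
  intros Ht. unfold radial, radial'. destruct (Req_dec alpha 0) as [->|Ha].
  - apply (is_derive_ext (fun t => - omega * t ^ 2)).
    + intros u. unfold Rdiv. rewrite Rmult_0_l. symmetry. apply Rplus_0_r.
    + auto_derive; trivial. unfold Rdiv. ring.
  - specialize (Ht Ha). auto_derive; [|field; trivial].
    now repeat apply Rmult_integral_contrapositive_currified; try apply R1_neq_R0.
Qed.

Lemma is_derive_radial' omega alpha t : (alpha <> 0 -> t <> 0) ->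
  is_derive (radial' omega alpha) t (- 2 * omega + 6 * alpha / t ^ 4).
Proof.
  intros Ht. unfold radial'. destruct (Req_dec alpha 0) as [->|Ha].
  - apply (is_derive_ext (fun t => - 2 * omega * t)).
    + intros u. unfold Rdiv. rewrite Rmult_0_r, Rmult_0_l. symmetry. apply Rminus_0_r.
    + auto_derive; trivial. unfold Rdiv. ring.
  - specialize (Ht Ha). auto_derive; [|field; trivial].
    now repeat apply Rmult_integral_contrapositive_currified; try apply R1_neq_R0.
Qed.

(** The operator [3 + t d/dt] annihilates [t ^ (- 3)] and multiplies [t] by 4, so [alpha] drops
    out. *)
Lemma radial_identity omega alpha t : (alpha <> 0 -> t <> 0) ->
  3 * radial' omega alpha t + t * (- 2 * omega + 6 * alpha / t ^ 4)
  = - 8 * omega * t.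
Proof.
  intros Ht. unfold radial'. destruct (Req_dec alpha 0) as [->|Ha].
  - unfold Rdiv. ring.
  - specialize (Ht Ha). field. trivial.
Qed.

Lemma smorodinsky_winternitz_radial omega alpha beta x y :
  smorodinsky_winternitz omega alpha beta x y
  = radial omega alpha x + radial omega beta y.
Proof. unfold smorodinsky_winternitz, radial. ring. Qed.

(** With xi for the linear factor, the equation says that [xi ^ 3 * (W + 2 * omega * xi)] has zero
    derivative along [(c, s)]. This product is therefore constant on all of [D], on both sides of
    the line [xi = 0] if [D] meets it. *)
Lemma radial_part D c s d omega W :
  open D -> connected_set D -> c * c + s * s = 1 -> smooth_on D W ->
  (forall x y, D (x, y) -> dir (- s) c W x y = 0) ->
  (forall x y, D (x, y) ->
    3 * W x y + lin c s d x y * dir c s W x y = - 8 * omega * lin c s d x y) ->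
  exists alpha, forall x y, D (x, y) ->
    (alpha <> 0 -> lin c s d x y <> 0) /\
    W x y = radial' omega alpha (lin c s d x y).
Proof.
  intros HD HC Hcs HW HY HX.
  set (g := fun x y => 2 * omega * lin c s d x y + W x y).
  assert (Hg : forall x y, D (x, y) -> exists l, is_dir c s g x y l).
  { intros x y Hxy. eexists. unfold g. solve_is_dir. }
  destruct (dir_zero_const D c s
    (fun x y => lin c s d x y * (lin c s d x y * (lin c s d x y * g x y)))
    HD HC Hcs) as [k Hk].
  { intros x y Hxy. split.
    - eassert (H : is_dir c s (fun x y => lin c s d x y * (lin c s d x y *
        (lin c s d x y * g x y))) x y _) by (unfold g; solve_is_dir).
      cbv beta in H. rewrite Hcs in H.
      (* The derivative of [xi ^ 3 * g] is [xi ^ 2] times the difference of the two sides of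
         [HX]. *)
      replace 0 with (lin c s d x y * lin c s d x y *
        (3 * W x y + lin c s d x y * dir c s W x y - - 8 * omega * lin c s d x y)).
      + eapply eq_ind; [exact H|]. unfold g. ring.
      + rewrite (HX x y Hxy). ring.
    - eassert (H : is_dir (- s) c (fun x y => lin c s d x y * (lin c s d x y *
        (lin c s d x y * g x y))) x y _) by (unfold g; solve_is_dir).
      cbv beta in H. rewrite (HY x y Hxy) in H.
      eapply eq_ind; [exact H|]. unfold g. ring. }
  (* From [xi ^ 3 * g = k] follows [W = - 2 * omega * xi + k / xi ^ 3], to be matched with the term
     [- 2 * alpha / xi ^ 3] of [radial']. *)
  exists (- k / 2). intros x y Hxy.
  destruct (Req_dec k 0) as [->|Hk0].
  - split; [intros Ha; exfalso; apply Ha; field|].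
    assert (E : g x y = 0).
    (* The three factors xi are cancelled one at a time, each time by differentiation, since xi may
       vanish in [D]. *)
    { revert x y Hxy. apply (lin_factor_zero D c s d); trivial.
      apply (lin_factor_zero D c s d (fun x y => lin c s d x y * g x y)); trivial.
      - apply (lin_factor_zero D c s d
          (fun x y => lin c s d x y * (lin c s d x y * g x y))); trivial.
        intros x y Hxy. eexists. unfold g. solve_is_dir.
      - intros x y Hxy. eexists. unfold g. solve_is_dir. }
    unfold g in E. unfold radial', Rdiv.
    rewrite Ropp_0, Rmult_0_l, Rmult_0_r, Rmult_0_l. lra.
  - specialize (Hk x y Hxy). cbv beta in Hk.
    assert (Hx : lin c s d x y <> 0) by (intros E; rewrite E in Hk; lra).
    split; trivial. unfold radial'. rewrite <- Hk. unfold g. field. trivial.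
Qed.

(* The Bertrand-Darboux equation of [L ^ 2], with [L] the angular momentum
   about the origin of the orthonormal frame with coordinates
   [lin c s d] and [lin (- s) c e]. *)
Definition polar_equation (c s d e : R) (V : R -> R -> R) (x y : R) : Prop :=
  lin c s d x y * (3 * dir (- s) c V x y
    + lin (- s) c e x y * dir (- s) c (dir (- s) c V) x y)
  - lin (- s) c e x y * (3 * dir c s V x y
    + lin c s d x y * dir c s (dir c s V) x y)
  + (lin c s d x y ^ 2 - lin (- s) c e x y ^ 2) * dir c s (dir (- s) c V) x y
  = 0.

(** Formally [V = f(xi) + g(eta)], and the polar equation reads [xi * (3 g' + eta g'') = eta * (3 f'
    + xi f'')]. Both brackets are then the same constant [tau] times their own coordinate. The
    constant is reached by differentiating rather than dividing, as xi and eta may vanish in [D]. *)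
Lemma separable_polar_sw D V c s d e :
  open D -> connected_set D -> c * c + s * s = 1 -> smooth_on D V ->
  (forall x y, D (x, y) -> dir c s (dir (- s) c V) x y = 0) ->
  (forall x y, D (x, y) -> polar_equation c s d e V x y) ->
  exists omega alpha beta k, forall x y, D (x, y) ->
    (alpha <> 0 -> lin c s d x y <> 0) /\
    (beta <> 0 -> lin (- s) c e x y <> 0) /\
    V x y = smorodinsky_winternitz omega alpha beta
              (lin c s d x y) (lin (- s) c e x y) + k.
Proof.
  intros HD HC Hcs HV H12 HP.
  set (V1 := dir c s V). set (V2 := dir (- s) c V). fold V2 in H12.
  assert (S1 : smooth_on D V1) by solve_smooth.
  assert (S2 : smooth_on D V2) by solve_smooth.
  set (V11 := dir c s V1). set (V22 := dir (- s) c V2).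
  assert (S11 : smooth_on D V11) by solve_smooth.
  assert (S22 : smooth_on D V22) by solve_smooth.
  assert (H21 : forall x y, D (x, y) -> dir (- s) c V1 x y = 0).
  { intros x y Hxy. unfold V1. rewrite (dir_comm D); auto. }
  assert (H112 : forall x y, D (x, y) -> dir (- s) c V11 x y = 0).
  { intros x y Hxy. unfold V11. rewrite (dir_comm D); trivial.
    exact (dir_zero_on D _ _ _ x y HD Hxy H21). }
  assert (H122 : forall x y, D (x, y) -> dir c s V22 x y = 0).
  { intros x y Hxy. unfold V22. rewrite (dir_comm D); trivial.
    exact (dir_zero_on D _ _ _ x y HD Hxy H12). }
  assert (E0 : forall x y, D (x, y) ->
    lin c s d x y * (3 * V2 x y + lin (- s) c e x y * V22 x y)
    - lin (- s) c e x y * (3 * V1 x y + lin c s d x y * V11 x y) = 0).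
  { intros x y Hxy. rewrite <- (HP x y Hxy).
    fold V1 V2 V11 V22. rewrite (H12 x y Hxy). ring. }
  assert (O1 : c * - s + s * c = 0) by ring.
  assert (O2 : - s * c + c * s = 0) by ring.
  assert (Hsc : - s * - s + c * c = 1) by lra.
  (* This is the derivative of [3 * V1 + xi * V11] along [(c, s)], which will turn out to be
     [tau]. *)
  set (T := fun x y => 4 * V11 x y + lin c s d x y * dir c s V11 x y).
  assert (EX : forall x y, D (x, y) ->
    3 * V2 x y + lin (- s) c e x y * V22 x y - lin (- s) c e x y * T x y = 0).
  { intros x y Hxy. differentiate c s E0 at x y as G.
    rewrite O1, Hcs, (H122 x y Hxy) in G. unfold T.
    fold V11 in G. rewrite (H12 x y Hxy) in G. lra. }
  (* In [EX] only [T] varies along [(c, s)], so a second derivative in that direction leaves eta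
     times the derivative of [T]. *)
  assert (TX : forall x y, D (x, y) -> dir c s T x y = 0).
  { apply (lin_factor_zero D (- s) c e); trivial.
    - intros x y Hxy.
      assert (HT : is_dir c s T x y (dir c s T x y)).
      { eassert (HT : is_dir c s T x y _) by (unfold T; solve_is_dir).
        now rewrite (is_dir_unique _ _ _ _ _ _ HT). }
      eassert (G : is_dir c s (fun x y => 3 * V2 x y + lin (- s) c e x y * V22 x y) x y _)
        by solve_is_dir.
      assert (G' := is_dir_zero_on D _ _ _ x y _ HD Hxy EX
        (is_dir_minus _ _ _ _ _ _ _ _ G
          (is_dir_mult _ _ _ _ _ _ _ _ (is_dir_lin _ _ _ _ e x y) HT))).
      rewrite O1, (H122 x y Hxy), (H12 x y Hxy) in G'. lra.
    - intros x y Hxy.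
      assert (HT : forall x y, D (x, y) -> dir c s T x y =
        5 * dir c s V11 x y + lin c s d x y * dir c s (dir c s V11) x y).
      { intros u v Huv. apply is_dir_unique.
        eassert (HT : is_dir c s T u v _) by (unfold T; solve_is_dir).
        rewrite Hcs in HT. cbv beta in HT. eapply eq_ind; [exact HT|]. ring. }
      eexists. apply (is_dir_ext_on D _ _ (fun x y =>
        5 * dir c s V11 x y + lin c s d x y * dir c s (dir c s V11) x y));
        trivial.
      + intros u v Huv. symmetry. auto.
      + solve_is_dir. }
  destruct (dir_zero_const D c s T HD HC Hcs) as [tau Htau].
  { intros x y Hxy. split.
    - eassert (HT : is_dir c s T x y _) by (unfold T; solve_is_dir).
      rewrite <- (TX x y Hxy). now rewrite (is_dir_unique _ _ _ _ _ _ HT).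
    - eassert (HT : is_dir (- s) c T x y _) by (unfold T; solve_is_dir).
      eapply eq_ind; [exact HT|]. cbv beta.
      rewrite (H112 x y Hxy), (dir_comm D), O2; trivial.
      rewrite (dir_zero_on D _ _ _ x y HD Hxy H112). ring. }
  assert (EQ : forall x y, D (x, y) ->
    3 * V2 x y + lin (- s) c e x y * V22 x y - tau * lin (- s) c e x y = 0).
  { intros x y Hxy. rewrite <- (Htau x y Hxy), <- (EX x y Hxy). ring. }
  (* Eliminating the eta bracket between [E0] and [EQ] gives eta times this equation; eta is then
     cancelled. *)
  assert (EP : forall x y, D (x, y) ->
    3 * V1 x y + lin c s d x y * V11 x y - tau * lin c s d x y = 0).
  { apply (lin_factor_zero D (- s) c e); trivial.
    - intros x y Hxy.
      transitivity (lin c s d x y * (3 * V2 x y + lin (- s) c e x y * V22 x y - tau * lin (- s) c e x y)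
       - (lin c s d x y * (3 * V2 x y + lin (- s) c e x y * V22 x y)
    - lin (- s) c e x y * (3 * V1 x y + lin c s d x y * V11 x y))); [ring|].
      rewrite (EQ x y Hxy), (E0 x y Hxy). ring.
    - intros x y Hxy. eexists. solve_is_dir. }
  (* Chosen so that [tau = - 8 * omega], the coefficient in [radial_part]. *)
  set (omega := - tau / 8).
  destruct (radial_part D c s d omega V1) as [alpha Ha]; trivial.
  { intros x y Hxy. fold V11. generalize (EP x y Hxy). unfold omega. lra. }
  destruct (radial_part D (- s) c e omega V2) as [beta Hb]; trivial.
  { intros x y Hxy. generalize (H12 x y Hxy). fold V2. unfold dir. lra. }
  { intros x y Hxy. fold V22. generalize (EQ x y Hxy). unfold omega. lra. }
  destruct (dir_zero_const D c s (fun x y => V x y -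
    (radial omega alpha (lin c s d x y) + radial omega beta (lin (- s) c e x y)))
    HD HC Hcs) as [k Hk].
  { intros x y Hxy. destruct (Ha x y Hxy) as [Ha0 Ha1].
    destruct (Hb x y Hxy) as [Hb0 Hb1].
    assert (F : forall a b, is_dir a b (fun x y => V x y -
      (radial omega alpha (lin c s d x y) + radial omega beta (lin (- s) c e x y))) x y
      (dir a b V x y - ((a * c + b * s) * V1 x y + (a * - s + b * c) * V2 x y))).
    { intros a b. rewrite Ha1, Hb1.
      apply (is_dir_minus _ _ V); [now apply (is_dir_smooth D)|].
      apply (is_dir_plus _ _ (fun x y => radial omega alpha (lin c s d x y))
        (fun x y => radial omega beta (lin (- s) c e x y)));
        apply is_dir_comp_lin, is_derive_radial; assumption. }
    split; (eapply eq_ind; [apply F|]).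
    - fold V1. rewrite Hcs, O1. ring.
    - fold V2. rewrite Hsc, O2. ring. }
  exists omega, alpha, beta, k. intros x y Hxy.
  rewrite smorodinsky_winternitz_radial, <- (Hk x y Hxy).
  refine (conj _ (conj _ _)); [apply Ha | apply Hb | ring]; assumption.
Qed.

(* The Bertrand-Darboux equation of [L P + k P ^ 2] (doubled), where [P] is the momentum along
   [(c, s)]. *)
Definition parabolic_equation (c s d e k : R) (V : R -> R -> R) (x y : R) : Prop :=
  lin c s d x y *
    (dir c s (dir c s V) x y - dir (- s) c (dir (- s) c V) x y)
  + 2 * (lin (- s) c e x y - k) * dir c s (dir (- s) c V) x y
  + 3 * dir c s V x y = 0.

Lemma polar_parabolic_invariant D V c s d e k :
  open D -> c * c + s * s = 1 -> smooth_on D V -> k <> 0 ->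
  (forall x y, D (x, y) -> polar_equation c s d e V x y) ->
  (forall x y, D (x, y) -> parabolic_equation c s d e k V x y) ->
  forall x y, D (x, y) -> dir (- s) c V x y = 0.
Proof.
  (* With [rho = xi ^ 2 + (eta - k) ^ 2 - k ^ 2], the equations give
     [3 xi u + rho Xu = 0], i.e. [u = phi(eta) rho ^ (- 3 / 2)], and then [N = 0] below is
     [rho ^ 2 phi'' = 15 k ^ 2 phi], in which only [rho] depends on [xi]. *)
  intros HD Hcs HV Hk HP HQ.
  set (u := dir (- s) c V).
  assert (Su : smooth_on D u) by solve_smooth.
  set (u1 := dir c s u). set (u2 := dir (- s) c u).
  assert (S1 : smooth_on D u1) by solve_smooth.
  assert (S2 : smooth_on D u2) by solve_smooth.
  set (u11 := dir c s u1). set (u12 := dir (- s) c u1).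
  set (u22 := dir (- s) c u2).
  assert (S12 : smooth_on D u12) by solve_smooth.
  assert (S22 : smooth_on D u22) by solve_smooth.
  assert (C12 : forall x y, D (x, y) -> dir c s u2 x y = u12 x y).
  { intros x y Hxy. now apply (dir_comm D). }
  assert (C122 : forall x y, D (x, y) -> dir c s u22 x y = dir (- s) c u12 x y).
  { intros x y Hxy. unfold u22. rewrite (dir_comm D); trivial.
    now apply (dir_ext_on D). }
  assert (D2 : forall x y, D (x, y) ->
    dir (- s) c (dir c s V) x y = u1 x y).
  { intros x y Hxy. now apply (dir_comm D). }
  assert (D12 : forall x y, D (x, y) ->
    dir (- s) c (dir c s (dir c s V)) x y = u11 x y).
  { intros x y Hxy. rewrite (dir_comm D); trivial; [|solve_smooth].
    now apply (dir_ext_on D). }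
  assert (O1 : c * - s + s * c = 0) by ring.
  assert (O2 : - s * c + c * s = 0) by ring.
  assert (Hsc : - s * - s + c * c = 1) by lra.
  (* Adding eta times the parabolic equation to the polar one cancels the terms in [dir c s V] and
     its derivative along [(c, s)]; only [u] and [u1] survive. *)
  assert (A0 : forall x y, D (x, y) -> 3 * (lin c s d x y * u x y) +
    (lin c s d x y * lin c s d x y +
     (lin (- s) c e x y - k) * (lin (- s) c e x y - k) - k * k) * u1 x y = 0).
  { intros x y Hxy.
    assert (H1 := HP x y Hxy). assert (H2 := HQ x y Hxy).
    unfold polar_equation in H1. unfold parabolic_equation in H2.
    fold u u1 u2 in H1, H2.
    transitivity
      ((lin c s d x y * (3 * u x y + lin (- s) c e x y * u2 x y)
        - lin (- s) c e x y * (3 * dir c s V x y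
          + lin c s d x y * dir c s (dir c s V) x y)
        + (lin c s d x y ^ 2 - lin (- s) c e x y ^ 2) * u1 x y)
       + lin (- s) c e x y *
         (lin c s d x y * (dir c s (dir c s V) x y - u2 x y)
          + 2 * (lin (- s) c e x y - k) * u1 x y + 3 * dir c s V x y)); [ring|].
    rewrite H1, H2. ring. }
  assert (A1 : forall x y, D (x, y) -> 3 * u x y + 5 * lin c s d x y * u1 x y +
    (lin c s d x y * lin c s d x y +
     (lin (- s) c e x y - k) * (lin (- s) c e x y - k) - k * k) * u11 x y = 0).
  { intros x y Hxy. differentiate c s A0 at x y as G.
    rewrite Hcs, O1 in G. fold u1 u11 in G.
    rewrite <- G. ring. }
  assert (A2 : forall x y, D (x, y) -> 3 * (lin c s d x y * u2 x y)
    + 2 * (lin (- s) c e x y - k) * u1 x y +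
    (lin c s d x y * lin c s d x y +
     (lin (- s) c e x y - k) * (lin (- s) c e x y - k) - k * k) * u12 x y = 0).
  { intros x y Hxy. differentiate (- s) c A0 at x y as G.
    rewrite Hsc, O2 in G. fold u2 u12 in G.
    rewrite <- G. ring. }
  assert (A22 : forall x y, D (x, y) -> 3 * lin c s d x y * u22 x y
    + 2 * u1 x y + 4 * (lin (- s) c e x y - k) * u12 x y +
    (lin c s d x y * lin c s d x y +
     (lin (- s) c e x y - k) * (lin (- s) c e x y - k) - k * k)
      * dir (- s) c u12 x y = 0).
  { intros x y Hxy. differentiate (- s) c A2 at x y as G.
    rewrite Hsc, O2 in G. fold u12 u22 in G.
    rewrite <- G. ring. }
  (* One derivative of the parabolic equation along [(- s, c)] turns every term into a derivative of
     [u]. *)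
  assert (B : forall x y, D (x, y) ->
    lin c s d x y * (u11 x y - u22 x y) + 5 * u1 x y
    + 2 * (lin (- s) c e x y - k) * u12 x y = 0).
  { unfold parabolic_equation in HQ. intros x y Hxy.
    differentiate (- s) c HQ at x y as G.
    fold u u1 u2 in G. fold u12 u22 in G.
    rewrite Hsc, O2, D12, D2 in G by assumption.
    rewrite <- G. ring. }
  set (N := fun x y =>
    (lin c s d x y * lin c s d x y +
     (lin (- s) c e x y - k) * (lin (- s) c e x y - k) - k * k)
    * ((lin c s d x y * lin c s d x y +
     (lin (- s) c e x y - k) * (lin (- s) c e x y - k) - k * k) * u22 x y
     + 6 * (lin (- s) c e x y - k) * u2 x y)
    + (3 * (lin c s d x y * lin c s d x y)
       + 6 * ((lin (- s) c e x y - k) * (lin (- s) c e x y - k)) - 18 * (k * k))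
      * u x y).
  assert (HN : forall x y, D (x, y) -> N x y = 0).
  (* Clearing [u1], [u11] and [u12] from [B] by means of [A0], [A1] and [A2] yields xi times [N].
     Everything is multiplied by powers of [rho] instead of divided by them. *)
  { apply (lin_factor_zero D c s d); trivial.
    - intros x y Hxy.
      generalize (A0 x y Hxy) (A1 x y Hxy) (A2 x y Hxy) (B x y Hxy).
      unfold N. set (X := lin c s d x y). set (Y := lin (- s) c e x y - k).
      set (rho := X * X + Y * Y - k * k).
      intros F0 F1 F2 F3.
      transitivity (- (rho * rho)
          * (X * (u11 x y - u22 x y) + 5 * u1 x y + 2 * Y * u12 x y)
        + X * rho * (3 * u x y + 5 * X * u1 x y + rho * u11 x y)
        + 2 * Y * rho * (3 * (X * u2 x y) + 2 * Y * u1 x y + rho * u12 x y)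
        + (5 * rho - 5 * (X * X) - 4 * (Y * Y))
          * (3 * (X * u x y) + rho * u1 x y)); [unfold rho; ring|].
      rewrite F0, F1, F2, F3. ring.
    - intros x y Hxy. eexists. unfold N. solve_is_dir. }
  assert (Hu : forall x y, D (x, y) -> lin c s d x y * u x y = 0).
  { intros x y Hxy. assert (HNx := HN x y Hxy). unfold N in HN, HNx.
    differentiate c s HN at x y as G.
    rewrite Hcs, O1, C12, C122 in G by assumption. fold u1 in G.
    revert HNx G.
    generalize (A0 x y Hxy) (A2 x y Hxy) (A22 x y Hxy).
    set (X := lin c s d x y). set (Y := lin (- s) c e x y - k).
    set (rho := X * X + Y * Y - k * k).
    intros F0 F2 F22 HNx G.
    (* In [rho] times the derivative of [N], all derivatives of [u] cancel against [N], [A22], [A2]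
       and [A0]; what remains is [60 * k ^ 2 * xi * u]. *)
    apply (Rmult_eq_reg_l (60 * (k * k))); [|nra].
    rewrite Rmult_0_r.
    match type of G with ?g = 0 => transitivity (rho * g
      - X * (rho * (rho * u22 x y + 6 * Y * u2 x y)
         + (3 * (X * X) + 6 * (Y * Y) - 18 * (k * k)) * u x y)
      - rho * rho * (3 * X * u22 x y + 2 * u1 x y + 4 * Y * u12 x y
         + rho * dir (- s) c u12 x y)
      - 2 * Y * rho * (3 * (X * u2 x y) + 2 * Y * u1 x y + rho * u12 x y)
      - (3 * (X * X) + 2 * (Y * Y) - 18 * (k * k) - 2 * rho)
        * (3 * (X * u x y) + rho * u1 x y)) end.
    - unfold rho. ring.
    - rewrite G, HNx, F22, F2, F0. ring. }
  apply (lin_factor_zero D c s d); trivial.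
  intros x y Hxy. eexists. now apply (is_dir_smooth D).
Qed.

(** * Killing tensors and their foci *)

Definition bertrand_darboux (b : killing_params) (V : R -> R -> R) (x y : R) : R :=
  (b3 b - b4 b * x - b5 b * y - b6 b * (x * y)) * (dx (dx V) x y - dy (dy V) x y)
  + ((b2 b + 2 * b5 b * x + b6 b * (x * x))
     - (b1 b + 2 * b4 b * y + b6 b * (y * y))) * dy (dx V) x y
  - 3 * (b4 b + b6 b * y) * dx V x y + 3 * (b5 b + b6 b * x) * dy V x y.

Lemma compatible_bertrand_darboux D K b V :
  open D -> smooth_on D V -> has_params K b ->
  compatible D K V <-> forall x y, D (x, y) -> bertrand_darboux b V x y = 0.
Proof.
  intros HD HV Hb.
  assert (S1 := smooth_dx D V HV). assert (S2 := smooth_dy D V HV).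
  enough (E : forall x y, D (x, y) ->
    dx (fun s t => K12 K s t * dx V s t + K22 K s t * dy V s t) x y
    - dy (fun s t => K11 K s t * dx V s t + K12 K s t * dy V s t) x y
    = bertrand_darboux b V x y).
  { unfold compatible. split; intros H x y Hxy.
    - rewrite <- E; auto.
    - rewrite E; auto. }
  intros x y Hxy.
  set (f := fun s t => K12 K s t * dx V s t + K22 K s t * dy V s t).
  set (g := fun s t => K11 K s t * dx V s t + K12 K s t * dy V s t).
  (* Squares are written as products, the form that the differentiation rules recognize. *)
  assert (F : forall u v, D (u, v) ->
    (b3 b - b4 b * u - b5 b * v - b6 b * (u * v)) * dx V u v
    + (b2 b + 2 * b5 b * u + b6 b * (u * u)) * dy V u v = f u v).
  { intros u v _. destruct (Hb u v) as (E1 & E2 & E3).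
    unfold f. rewrite E2, E3. ring. }
  assert (G : forall u v, D (u, v) ->
    (b1 b + 2 * b4 b * v + b6 b * (v * v)) * dx V u v
    + (b3 b - b4 b * u - b5 b * v - b6 b * (u * v)) * dy V u v = g u v).
  { intros u v _. destruct (Hb u v) as (E1 & E2 & E3).
    unfold g. rewrite E1, E2. ring. }
  replace (dx f x y) with (dir 1 0 f x y) by (unfold dir; ring).
  replace (dy g x y) with (dir 0 1 g x y) by (unfold dir; ring).
  match type of F with forall u v, _ -> @?P u v = _ =>
    eassert (F' : is_dir 1 0 P x y _) by solve_is_dir end.
  match type of G with forall u v, _ -> @?P u v = _ =>
    eassert (G' : is_dir 0 1 P x y _) by solve_is_dir end.
  rewrite (is_dir_unique _ _ _ _ _ _ (is_dir_ext_on D _ _ _ f x y _ HD Hxy F F')).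
  rewrite (is_dir_unique _ _ _ _ _ _ (is_dir_ext_on D _ _ _ g x y _ HD Hxy G G')).
  unfold bertrand_darboux, dir. rewrite (dx_dy_comm D V x y HD HV Hxy). ring.
Qed.

Lemma singular_point_iff K x y :
  singular_point K (x, y) <-> K12 K x y = 0 /\ K11 K x y = K22 K x y.
Proof.
  unfold singular_point, eigenvalue.
  set (A := K11 K x y). set (C := K12 K x y). set (B := K22 K x y).
  clearbody A B C. split.
  - intros H.
    (* The eigenvalues are [(A + B + r) / 2] and [(A + B - r) / 2]; for [C <> 0] they have
       eigenvectors with first entry [C], hence nonzero. *)
    set (r := sqrt ((A - B) ^ 2 + 4 * C ^ 2)).
    assert (Hr : r * r = (A - B) ^ 2 + 4 * C ^ 2) by (apply sqrt_sqrt;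
      generalize (pow2_ge_0 (A - B)) (pow2_ge_0 C); lra).
    destruct (Req_dec C 0) as [HC|HC].
    + split; trivial. apply H.
      * exists 1, 0. repeat split; rewrite ?HC; lra.
      * exists 0, 1. repeat split; rewrite ?HC; lra.
    + exfalso.
      assert (E : (A + B + r) / 2 = (A + B - r) / 2).
      { apply H.
        - exists C, ((B - A + r) / 2). repeat split; [tauto | field | nra].
        - exists C, ((B - A - r) / 2). repeat split; [tauto | field | nra]. }
      assert (r = 0) as -> by lra.
      generalize (pow2_ge_0 (A - B)) (pow2_gt_0 C HC). lra.
  - intros [HC HAB] l m (u & v & Huv & H1 & H2) (u' & v' & Huv' & H1' & H2').
    rewrite HC in *. rewrite <- HAB in *.
    assert (Q : forall l u v, ~ (u = 0 /\ v = 0) -> A * u + 0 * v = l * u ->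
      0 * u + A * v = l * v -> l = A).
    { clear. intros l u v Huv H1 H2. destruct (Req_dec u 0) as [Hu|Hu].
      - apply (Rmult_eq_reg_r v); [lra | tauto].
      - apply (Rmult_eq_reg_r u); [lra | trivial]. }
    rewrite (Q l u v Huv H1 H2). symmetry. now apply (Q m u' v').
Qed.

(* [(p, q)] is the midpoint of the two foci. *)
Definition center (b : killing_params) : point := (- b5 b / b6 b, - b4 b / b6 b).

(** Completing squares, with [z] and [m] the complex numbers of the point and the center, the two
    equations are the real part and half the imaginary part of [b6 b * (z - m) ^ 2 = w] for a
    constant [w]. The foci are thus [m + v] and [m - v]. *)
Lemma singular_point_center K b x y :
  has_params K b -> b6 b <> 0 ->
  let (p, q) := center b in
  singular_point K (x, y) <->
  b6 b * ((x - p) * (y - q)) = b3 b + b6 b * (p * q) /\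
  b6 b * ((x - p) ^ 2 - (y - q) ^ 2)
  = b1 b - b2 b - b6 b * q ^ 2 + b6 b * p ^ 2.
Proof.
  intros Hb H6. unfold center. rewrite singular_point_iff.
  destruct (Hb x y) as (-> & -> & ->).
  set (p := - b5 b / b6 b). set (q := - b4 b / b6 b).
  replace (b5 b) with (- (b6 b * p)) by (unfold p; field; trivial).
  replace (b4 b) with (- (b6 b * q)) by (unfold q; field; trivial).
  split; intros [H1 H2]; split; lra.
Qed.

(** The value is [b6 b ^ 2] times the squared modulus of the constant [w] whose quotient by [b6 b]
    is the square of the half-vector between the foci; it vanishes exactly when the foci
    coincide. *)
Lemma focal_invariant_center b : b6 b <> 0 ->
  let (p, q) := center b in
  focal_invariant b =
  b6 b ^ 2 * ((b1 b - b2 b - b6 b * q ^ 2 + b6 b * p ^ 2) ^ 2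
              + 4 * (b3 b + b6 b * (p * q)) ^ 2).
Proof. intros H6. unfold center, focal_invariant. field. trivial. Qed.

(** The Bertrand-Darboux operator of the squared angular momentum about [(p, q)], in Cartesian
    form. *)
Definition polar_xy (p q : R) (V : R -> R -> R) (x y : R) : R :=
  3 * ((x - p) * dy V x y - (y - q) * dx V x y)
  + (x - p) * (y - q) * (dy (dy V) x y - dx (dx V) x y)
  + ((x - p) ^ 2 - (y - q) ^ 2) * dy (dx V) x y.

Lemma bertrand_darboux_center b V x y : b6 b <> 0 ->
  let (p, q) := center b in
  bertrand_darboux b V x y =
  b6 b * polar_xy p q V x y
  + (b3 b + b6 b * (p * q)) * (dx (dx V) x y - dy (dy V) x y)
  - (b1 b - b2 b - b6 b * q ^ 2 + b6 b * p ^ 2) * dy (dx V) x y.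
Proof. intros H6. unfold center, bertrand_darboux, polar_xy. field. trivial. Qed.

Lemma polar_equation_xy D V c s p q x y :
  open D -> smooth_on D V -> D (x, y) -> c * c + s * s = 1 ->
  polar_equation c s (- (c * p + s * q)) (s * p - c * q) V x y
  <-> polar_xy p q V x y = 0.
Proof.
  intros HD HV Hxy Hcs. unfold polar_equation.
  rewrite !(dir_dir D) by assumption. unfold dir, lin, polar_xy.
  match goal with |- ?l = 0 <-> ?r = 0 =>
    (* The first-order terms have degree two in [(c, s)] and the second-order terms degree four,
       hence the correction by [c * c + s * s - 1]. *)
    replace l with ((c * c + s * s) * r
      + (c * c + s * s) * ((c * c + s * s) - 1) *
        ((x - p) * (y - q) * (dy (dy V) x y - dx (dx V) x y)
         + ((x - p) ^ 2 - (y - q) ^ 2) * dy (dx V) x y)) by ring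
  end.
  rewrite Hcs. split; intros H; lra.
Qed.

(** Moving the center by [h] along [(- s, c)] replaces the angular momentum [L] by [L + h P], with
    [P] the momentum along [(c, s)]. The three terms belong to [L ^ 2], [2 h L P] and
    [h ^ 2 P ^ 2]. *)
Lemma polar_xy_shift D V c s p q h x y :
  open D -> smooth_on D V -> D (x, y) -> c * c + s * s = 1 ->
  let d := - (c * p + s * q) in let e := s * p - c * q in
  polar_xy (p - h * s) (q + h * c) V x y =
  polar_xy p q V x y
  + h * (lin c s d x y *
           (dir c s (dir c s V) x y - dir (- s) c (dir (- s) c V) x y)
         + 2 * lin (- s) c e x y * dir c s (dir (- s) c V) x y
         + 3 * dir c s V x y)
  - h ^ 2 * dir c s (dir (- s) c V) x y.
Proof.
  intros HD HV Hxy Hcs d e.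
  rewrite !(dir_dir D) by assumption. unfold dir, lin, polar_xy, d, e.
  match goal with |- ?l = ?r =>
    replace r with (l + ((c * c + s * s) - 1) * h *
      (((x - p) * c - (y - q) * s) * (dx (dx V) x y - dy (dy V) x y)
       + 2 * ((x - p) * s + (y - q) * c) * dy (dx V) x y)) by ring
  end.
  rewrite Hcs. ring.
Qed.

Lemma unit_vector_angle c s : c * c + s * s = 1 ->
  exists theta, cos theta = c /\ sin theta = s.
Proof.
  intros H. assert (Hc : -1 <= c <= 1) by nra.
  destruct (Rle_dec 0 s) as [Hs|Hs].
  - exists (acos c). split; [now apply cos_acos|].
    rewrite sin_acos by trivial. apply sqrt_lem_1; unfold Rsqr; nra.
  - exists (- acos c). rewrite cos_neg, sin_neg. split; [now apply cos_acos|].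
    rewrite sin_acos by trivial.
    rewrite (sqrt_lem_1 _ (- s)); unfold Rsqr; nra.
Qed.

(** * From the invariant conditions to the potential *)

Lemma compatible_pair_sw D V K1 K2 :
  open D -> connected_set D -> smooth_on D V ->
  compatible D K1 V -> compatible D K2 V -> invariant_conditions K1 K2 ->
  is_smorodinsky_winternitz D V.
Proof.
  intros HD HC HV HK1 HK2
    (a & b & [x1 y1] & [x2 y2] & [x3 y3] & S4 & Pa & Pb & F2 & F1 & Ha & Fa & Hb & Fb
     & Hd & _).
  unfold dist2 in Hd. simpl in Hd.
  assert (T1 := singular_point_center K1 a x3 y3 Pa Ha).
  assert (I1 := focal_invariant_center a Ha).
  assert (BD1 := fun x y => bertrand_darboux_center a V x y Ha).
  destruct (center a) as [p q]. rewrite I1 in Fa.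
  set (Ca := b3 a + b6 a * (p * q)) in *.
  set (Aa := b1 a - b2 a - b6 a * q ^ 2 + b6 a * p ^ 2) in *.
  (* A vanishing sum of real squares kills the constant part of [K1] modulo the metric, leaving the
     angular momentum about its center. *)
  assert (Hsum : Aa ^ 2 + 4 * Ca ^ 2 = 0).
  { destruct (Rmult_integral _ _ Fa) as [H|H]; trivial.
    exfalso. exact (pow_nonzero _ 2 Ha H). }
  assert (Ca0 : Ca = 0) by (generalize (pow2_ge_0 Aa); nra).
  assert (Aa0 : Aa = 0) by nra.
  assert (E3 : x3 = p /\ y3 = q).
  { destruct (proj1 T1 (proj2 (F1 (x3, y3)) (or_introl eq_refl))) as [G1 G2].
    rewrite Ca0 in G1. rewrite Aa0 in G2.
    assert (G1' : (x3 - p) * (y3 - q) = 0)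
      by (destruct (Rmult_integral _ _ G1); tauto).
    assert (G2' : (x3 - p) ^ 2 - (y3 - q) ^ 2 = 0)
      by (destruct (Rmult_integral _ _ G2); tauto).
    destruct (Rmult_integral _ _ G1') as [Z|Z]; rewrite Z in G2'; split; nra. }
  destruct E3 as [-> ->]. clear T1 F1.
  assert (P1 : forall x y, D (x, y) -> polar_xy p q V x y = 0).
  { intros x y Hxy.
    assert (G := proj1 (compatible_bertrand_darboux D K1 a V HD HV Pa) HK1 x y Hxy).
    rewrite BD1, Ca0, Aa0 in G.
    apply (Rmult_eq_reg_l (b6 a)); [lra | trivial]. }
  assert (T2 := fun x y => singular_point_center K2 b x y Pb Hb).
  assert (I2 := focal_invariant_center b Hb).
  assert (BD2 := fun x y => bertrand_darboux_center b V x y Hb).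
  destruct (center b) as [m1 m2]. rewrite I2 in Fb.
  set (Cb := b3 b + b6 b * (m1 * m2)) in *.
  set (Ab := b1 b - b2 b - b6 b * m2 ^ 2 + b6 b * m1 ^ 2) in *.
  destruct (proj1 (T2 x1 y1) (proj2 (F2 (x1, y1)) (or_introl eq_refl))) as [G1 G2].
  (* The set of foci is symmetric about the center, which is not a focus. *)
  assert (Hne : ~ (x1 = m1 /\ y1 = m2)).
  { intros [-> ->]. apply Fb. rewrite <- G1, <- G2. ring. }
  assert (E2 : x2 = 2 * m1 - x1 /\ y2 = 2 * m2 - y1).
  { assert (G : singular_point K2 (2 * m1 - x1, 2 * m2 - y1)).
    { apply T2. rewrite <- G1, <- G2. split; ring. }
    apply F2 in G. destruct G as [G|G]; injection G; intros; [|now split].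
    exfalso. apply Hne. split; lra. }
  destruct E2 as [-> ->].
  set (v1 := x1 - m1) in *. set (v2 := y1 - m2) in *.
  set (r := sqrt (v1 * v1 + v2 * v2)).
  assert (Hv : 0 < v1 * v1 + v2 * v2).
  { destruct (Req_dec v1 0) as [Z|Z]; [destruct (Req_dec v2 0) as [Z'|Z']|].
    - exfalso. apply Hne. unfold v1 in Z. unfold v2 in Z'. lra.
    - generalize (pow2_gt_0 v2 Z') (pow2_ge_0 v1). lra.
    - generalize (pow2_gt_0 v1 Z) (pow2_ge_0 v2). lra. }
  assert (Hr : 0 < r) by now apply sqrt_lt_R0.
  assert (Hrr : r * r = v1 * v1 + v2 * v2) by (apply sqrt_sqrt; lra).
  set (c := v1 / r). set (s := v2 / r).
  assert (Ev1 : v1 = r * c) by (unfold c; field; lra).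
  assert (Ev2 : v2 = r * s) by (unfold s; field; lra).
  assert (Hcs : c * c + s * s = 1).
  { apply (Rmult_eq_reg_l (r * r)); [|nra].
    rewrite Hrr at 2. rewrite Ev1, Ev2. ring. }
  set (h := - s * (m1 - p) + c * (m2 - q)).
  (* The foci [m + v] and [m - v] are equidistant from [(p, q)], so [m - (p, q)] is orthogonal to
     [v]. *)
  assert (Horth : c * (m1 - p) + s * (m2 - q) = 0).
  { apply (Rmult_eq_reg_l r); [|lra].
    replace (r * (c * (m1 - p) + s * (m2 - q)))
      with (r * c * (m1 - p) + r * s * (m2 - q)) by ring.
    rewrite <- Ev1, <- Ev2. unfold v1, v2. lra. }
  assert (Em1 : m1 = p - h * s).
  { transitivity (p + (c * c + s * s) * (m1 - p)); [rewrite Hcs; ring|].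
    transitivity (p - h * s + c * (c * (m1 - p) + s * (m2 - q)));
      [unfold h; ring | rewrite Horth; ring]. }
  assert (Em2 : m2 = q + h * c).
  { transitivity (q + (c * c + s * s) * (m2 - q)); [rewrite Hcs; ring|].
    transitivity (q + h * c + s * (c * (m1 - p) + s * (m2 - q)));
      [unfold h; ring | rewrite Horth; ring]. }
  set (d := - (c * p + s * q)). set (e := s * p - c * q).
  (* By [G1] and [G2] the constant part of [K2] is [b6 b] times the squared momentum along [v], that
     is [r ^ 2 P ^ 2]. Subtracting the equation of [L ^ 2] leaves that of
     [2 h L P + (h ^ 2 + r ^ 2) P ^ 2]. *)
  assert (P2 : forall x y, D (x, y) ->
    h * (lin c s d x y *
           (dir c s (dir c s V) x y - dir (- s) c (dir (- s) c V) x y)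
         + 2 * lin (- s) c e x y * dir c s (dir (- s) c V) x y
         + 3 * dir c s V x y)
    - (h ^ 2 + r ^ 2) * dir c s (dir (- s) c V) x y = 0).
  { intros x y Hxy.
    assert (G := proj1 (compatible_bertrand_darboux D K2 b V HD HV Pb) HK2 x y Hxy).
    rewrite BD2, <- G1, <- G2, Em1, Em2 in G.
    rewrite (polar_xy_shift D V c s) in G by assumption. cbv zeta in G.
    fold d e in G. rewrite (P1 x y Hxy), Ev1, Ev2 in G.
    apply (Rmult_eq_reg_l (b6 b)); [|trivial]. rewrite Rmult_0_r, <- G.
    rewrite (dir_dir D c s (- s) c) by assumption. ring. }
  assert (PE : forall x y, D (x, y) -> polar_equation c s d e V x y).
  { intros x y Hxy. apply (polar_equation_xy D); auto. }
  assert (H12 : forall x y, D (x, y) -> dir c s (dir (- s) c V) x y = 0).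
  { destruct (Req_dec h 0) as [Hh|Hh].
    - intros x y Hxy. generalize (P2 x y Hxy). rewrite Hh. intros G.
      apply (Rmult_eq_reg_l (r * r)); nra.
    - intros x y Hxy. apply (dir_zero_on D); trivial.
      (* Division of [2 h L P + (h ^ 2 + r ^ 2) P ^ 2] by [2 h] gives this value of [k], nonzero
         because [r > 0]. *)
      apply (polar_parabolic_invariant D V c s d e ((h ^ 2 + r ^ 2) / (2 * h))); trivial.
      + intros K. apply (Rmult_eq_compat_r (2 * h)) in K. revert K.
        unfold Rdiv. rewrite Rmult_assoc, Rinv_l by lra. nra.
      + intros u v Huv. unfold parabolic_equation.
        apply (Rmult_eq_reg_l h); trivial. rewrite Rmult_0_r, <- (P2 u v Huv).
        field. trivial. }
  destruct (separable_polar_sw D V c s d e HD HC Hcs HV H12 PE)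
    as (omega & alpha & beta & k & H).
  destruct (unit_vector_angle c s Hcs) as (theta & Hc & Hs).
  exists theta, p, q, omega, alpha, beta, k. intros x y. unfold rigid_motion.
  rewrite Hc, Hs. simpl. intros Hxy.
  destruct (H _ _ Hxy) as (H1 & H2 & H3).
  assert (L1 : lin c s d (c * x - s * y + p) (s * x + c * y + q) = x).
  { transitivity ((c * c + s * s) * x); [unfold lin, d; ring | rewrite Hcs; ring]. }
  assert (L2 : lin (- s) c e (c * x - s * y + p) (s * x + c * y + q) = y).
  { transitivity ((c * c + s * s) * y); [unfold lin, e; ring | rewrite Hcs; ring]. }
  rewrite L1 in H1, H3. rewrite L2 in H2, H3. auto.
Qed.

(** * Construction of a compatible pair for a given potential *)

Definition tensor_of (b : killing_params) : sym_tensor :=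
  SymTensor (fun x y => b1 b + 2 * b4 b * y + b6 b * y ^ 2)
            (fun x y => b3 b - b4 b * x - b5 b * y - b6 b * x * y)
            (fun x y => b2 b + 2 * b5 b * x + b6 b * x ^ 2).

Lemma tensor_of_params b : has_params (tensor_of b) b.
Proof. intros x y. repeat split. Qed.

Lemma smooth_minus D f g : open D ->
  smooth_on D f -> smooth_on D g -> smooth_on D (fun x y => f x y - g x y).
Proof.
  intros HD Hf Hg x y Hxy n.
  apply (ex_diff_n_ext_loc (fun u v => f u v + (-1) * g u v)).
  - apply locally_2d_forall. intros u v. ring.
  - apply (smooth_plus D f (fun u v => (-1) * g u v)); trivial.
    apply (smooth_mult D (fun _ _ => -1)); trivial. apply smooth_const.
Qed.

Lemma tensor_of_killing b : killing (tensor_of b).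
Proof.
  set (D := fun _ : point => True).
  assert (HD : open D) by apply open_true.
  assert (M : forall k f, smooth_on D f -> smooth_on D (fun x y => k * f x y)).
  { intros k f Hf. apply (smooth_mult D (fun _ _ => k)); trivial. apply smooth_const. }
  assert (X := smooth_fst D). assert (Y := smooth_snd D).
  assert (C := smooth_const D).
  refine (conj _ (conj _ (conj _ _))); simpl.
  - apply (smooth_plus D (fun _ y => b1 b + 2 * b4 b * y) (fun _ y => b6 b * y ^ 2)); trivial.
    + apply (smooth_plus D (fun _ _ => b1 b) (fun _ y => 2 * b4 b * y)); trivial.
      now apply (M (2 * b4 b) (fun _ y => y)).
    + apply (M (b6 b) (fun _ y => y ^ 2)).
      apply (smooth_mult D (fun _ y => y) (fun _ y => y * 1)); trivial.
      now apply (smooth_mult D (fun _ y => y) (fun _ y => 1)).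
  - apply (smooth_minus D (fun x y => b3 b - b4 b * x - b5 b * y)
      (fun x y => b6 b * x * y)); trivial.
    + apply (smooth_minus D (fun x y => b3 b - b4 b * x) (fun x y => b5 b * y)); trivial.
      * apply (smooth_minus D (fun x y => b3 b) (fun x y => b4 b * x)); trivial.
        now apply (M (b4 b) (fun x y => x)).
      * now apply (M (b5 b) (fun x y => y)).
    + apply (smooth_mult D (fun x y => b6 b * x) (fun x y => y)); trivial.
      now apply (M (b6 b) (fun x y => x)).
  - apply (smooth_plus D (fun x _ => b2 b + 2 * b5 b * x) (fun x _ => b6 b * x ^ 2)); trivial.
    + apply (smooth_plus D (fun _ _ => b2 b) (fun x _ => 2 * b5 b * x)); trivial.
      now apply (M (2 * b5 b) (fun x _ => x)).
    + apply (M (b6 b) (fun x _ => x ^ 2)).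
      apply (smooth_mult D (fun x _ => x) (fun x _ => x * 1)); trivial.
      now apply (smooth_mult D (fun x _ => x) (fun x _ => 1)).
  (* The metric is constant, so the terms with momentum derivatives of the tensor vanish; the
     remaining cubic in the momenta cancels. *)
  - intros x y p q. unfold schouten.
    assert (E1 : Derive (fun t => symbol (tensor_of b) t y p q) x =
      2 * (- b4 b - b6 b * y) * p * q + (2 * b5 b + 2 * b6 b * x) * q ^ 2)
      by (apply is_derive_unique; unfold symbol; simpl; auto_derive; trivial; ring).
    assert (E2 : Derive (fun t => symbol (tensor_of b) x t p q) y =
      (2 * b4 b + 2 * b6 b * y) * p ^ 2 + 2 * (- b5 b - b6 b * x) * p * q)
      by (apply is_derive_unique; unfold symbol; simpl; auto_derive; trivial; ring).
    assert (E3 : Derive (fun t => symbol metric t y p q) x = 0)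
      by (apply is_derive_unique; unfold symbol; simpl; auto_derive; trivial; ring).
    assert (E4 : Derive (fun t => symbol metric x t p q) y = 0)
      by (apply is_derive_unique; unfold symbol; simpl; auto_derive; trivial; ring).
    assert (E5 : Derive (fun t => symbol metric x y t q) p = 2 * p)
      by (apply is_derive_unique; unfold symbol; simpl; auto_derive; trivial; ring).
    assert (E6 : Derive (fun t => symbol metric x y p t) q = 2 * q)
      by (apply is_derive_unique; unfold symbol; simpl; auto_derive; trivial; ring).
    rewrite E1, E2, E3, E4, E5, E6. ring.
Qed.

(** The potential is a sum of a function of xi and one of eta, so the mixed derivative vanishes. By
    [radial_identity] the brackets of the polar equation are [- 8 * omega] times eta and xi, and the
    cross products cancel. *)
Lemma sw_derivatives D V c s d e omega alpha beta k :
  open D -> smooth_on D V -> c * c + s * s = 1 ->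
  (forall x y, D (x, y) ->
    (alpha <> 0 -> lin c s d x y <> 0) /\
    (beta <> 0 -> lin (- s) c e x y <> 0) /\
    V x y = smorodinsky_winternitz omega alpha beta
              (lin c s d x y) (lin (- s) c e x y) + k) ->
  forall x y, D (x, y) ->
    dir c s (dir (- s) c V) x y = 0 /\ polar_equation c s d e V x y.
Proof.
  intros HD HV Hcs H.
  assert (O1 : c * - s + s * c = 0) by ring.
  assert (O2 : - s * c + c * s = 0) by ring.
  assert (Hsc : - s * - s + c * c = 1) by lra.
  assert (F : forall a b x y, D (x, y) -> dir a b V x y =
    (a * c + b * s) * radial' omega alpha (lin c s d x y)
    + (a * - s + b * c) * radial' omega beta (lin (- s) c e x y)).
  { intros a b x y Hxy. destruct (H x y Hxy) as (H1 & H2 & _).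
    apply is_dir_unique.
    apply (is_dir_ext_on D _ _ (fun x y => radial omega alpha (lin c s d x y)
      + radial omega beta (lin (- s) c e x y) + k)); trivial.
    - intros u v Huv. destruct (H u v Huv) as (_ & _ & ->).
      now rewrite smorodinsky_winternitz_radial.
    - rewrite <- (Rplus_0_r (_ + _)).
      apply (is_dir_plus _ _ (fun x y => radial omega alpha (lin c s d x y)
        + radial omega beta (lin (- s) c e x y)) (fun _ _ => k)); [|apply is_dir_const].
      apply (is_dir_plus _ _ (fun x y => radial omega alpha (lin c s d x y))
        (fun x y => radial omega beta (lin (- s) c e x y)));
        apply is_dir_comp_lin, is_derive_radial; assumption. }
  assert (F1 : forall x y, D (x, y) ->
    dir c s V x y = radial' omega alpha (lin c s d x y)).
  { intros x y Hxy. rewrite F, Hcs, O1 by trivial. ring. }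
  assert (F2 : forall x y, D (x, y) ->
    dir (- s) c V x y = radial' omega beta (lin (- s) c e x y)).
  { intros x y Hxy. rewrite F, Hsc, O2 by trivial. ring. }
  intros x y Hxy. destruct (H x y Hxy) as (H1 & H2 & _).
  assert (F11 : dir c s (dir c s V) x y = - 2 * omega + 6 * alpha / lin c s d x y ^ 4).
  { rewrite (dir_ext_on D c s _ _ x y HD Hxy F1).
    rewrite <- (Rmult_1_l (_ + _)), <- Hcs.
    apply is_dir_unique, is_dir_comp_lin, is_derive_radial'. trivial. }
  assert (F22 : dir (- s) c (dir (- s) c V) x y
    = - 2 * omega + 6 * beta / lin (- s) c e x y ^ 4).
  { rewrite (dir_ext_on D (- s) c _ _ x y HD Hxy F2).
    rewrite <- (Rmult_1_l (_ + _)), <- Hsc.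
    apply is_dir_unique, is_dir_comp_lin, is_derive_radial'. trivial. }
  assert (F12 : dir c s (dir (- s) c V) x y = 0).
  { rewrite (dir_ext_on D c s _ _ x y HD Hxy F2).
    rewrite <- (Rmult_0_l (- 2 * omega + 6 * beta / lin (- s) c e x y ^ 4)), <- O1.
    apply is_dir_unique, is_dir_comp_lin, is_derive_radial'. trivial. }
  split; trivial. unfold polar_equation.
  rewrite F12, F11, F22, F1, F2, !radial_identity by trivial. ring.
Qed.

Lemma sw_compatible_pair D V :
  open D -> smooth_on D V -> is_smorodinsky_winternitz D V ->
  exists K1 K2 : sym_tensor,
    killing K1 /\ killing K2 /\
    compatible D K1 V /\ compatible D K2 V /\ invariant_conditions K1 K2.
Proof.
  intros HD HV (theta & p & q & omega & alpha & beta & k & H).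
  unfold rigid_motion in H. simpl in H.
  set (c := cos theta) in *. set (s := sin theta) in *.
  assert (Hcs : c * c + s * s = 1).
  { rewrite Rplus_comm. apply (sin2_cos2 theta). }
  set (d := - (c * p + s * q)). set (e := s * p - c * q).
  assert (W : forall x y, D (x, y) ->
    dir c s (dir (- s) c V) x y = 0 /\ polar_equation c s d e V x y).
  { apply (sw_derivatives D V c s d e omega alpha beta k); trivial.
    intros x y Hxy.
    assert (E1 : c * lin c s d x y - s * lin (- s) c e x y + p = x).
    { transitivity ((c * c + s * s) * (x - p) + p);
        [unfold lin, d, e; ring | rewrite Hcs; ring]. }
    assert (E2 : s * lin c s d x y + c * lin (- s) c e x y + q = y).
    { transitivity ((c * c + s * s) * (y - q) + q);
        [unfold lin, d, e; ring | rewrite Hcs; ring]. }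
    specialize (H (lin c s d x y) (lin (- s) c e x y)).
    rewrite E1, E2 in H. auto. }
  (* [K1] is the square of the angular momentum about [(p, q)], and [K2] is [K1]
     plus the square of the momentum along [(c, s)], with foci [(p, q) +- (c, s)]. *)
  set (b := fun t => KillingParams (q ^ 2 + t * c ^ 2) (p ^ 2 + t * s ^ 2)
              (- (p * q) + t * (c * s)) (- q) (- p) 1).
  (* The Bertrand-Darboux equation is affine in [t]: the polar equation minus [t] times the mixed
     derivative, both zero by [W]. *)
  assert (HC : forall t, compatible D (tensor_of (b t)) V).
  { intros t. apply (compatible_bertrand_darboux D _ (b t) V HD HV).
    - apply tensor_of_params.
    - intros x y Hxy. destruct (W x y Hxy) as [W1 W2].
      apply (polar_equation_xy D) in W2; trivial.
      rewrite (dir_dir D) in W1 by trivial.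
      unfold polar_xy in W2. unfold bertrand_darboux. simpl.
      match type of W1 with ?w1 = 0 => match type of W2 with ?w2 = 0 =>
        transitivity (w2 - t * w1); [ring | rewrite W1, W2; ring] end end. }
  exists (tensor_of (b 0)), (tensor_of (b 1)).
  refine (conj (tensor_of_killing _) (conj (tensor_of_killing _)
    (conj (HC 0) (conj (HC 1) _)))).
  exists (b 0), (b 1), (p + c, q + s), (p - c, q - s), (p, q), (p, q).
  refine (conj (tensor_of_params _) (conj (tensor_of_params _) _)).
  assert (SP : forall t x y, singular_point (tensor_of (b t)) (x, y) <->
    (x - p) * (y - q) = t * (c * s) /\
    (x - p) ^ 2 - (y - q) ^ 2 = t * (c ^ 2 - s ^ 2)).
  { intros t x y. rewrite singular_point_iff. simpl. split; intros [G1 G2]; split; lra. }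
  refine (conj _ (conj _ (conj _ (conj _ (conj _ (conj _ (conj _ _))))))).
  - intros [x y]. rewrite SP. split.
    + intros [G1 G2].
      set (X := x - p) in *. set (Y := y - q) in *.
      (* [(X + i Y) ^ 2 = (c + i s) ^ 2] *)
      assert (G : (c * X + s * Y) ^ 2 = 1 /\ c * Y = s * X).
      { assert (N : X * X + Y * Y = 1).
        { assert ((X * X + Y * Y) ^ 2 = 1 ^ 2).
          { transitivity ((X ^ 2 - Y ^ 2) ^ 2 + 4 * (X * Y) ^ 2); [ring|].
            rewrite G1, G2.
            transitivity ((c * c + s * s) ^ 2); [ring | now rewrite Hcs]. }
          nra. }
        assert (X2 : X * X = c * c) by lra. assert (Y2 : Y * Y = s * s) by lra.
        split.
        - transitivity (c * c * (X * X) + 2 * (c * s) * (X * Y) + s * s * (Y * Y)); [ring|].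
          rewrite X2, Y2, G1.
          transitivity ((c * c + s * s) ^ 2); [ring | rewrite Hcs; ring].
        - assert (Z : (c * Y - s * X) * (c * Y - s * X) = 0).
          { transitivity (c * c * (Y * Y) - 2 * (c * s) * (X * Y) + s * s * (X * X)); [ring|].
            rewrite X2, Y2, G1. ring. }
          destruct (Rmult_integral _ _ Z); lra. }
      destruct G as [G3 G4].
      assert (EX : X = c * (c * X + s * Y)).
      { transitivity ((c * c + s * s) * X); [rewrite Hcs; ring|].
        transitivity (c * c * X + s * (s * X)); [ring | rewrite <- G4; ring]. }
      assert (EY : Y = s * (c * X + s * Y)).
      { transitivity ((c * c + s * s) * Y); [rewrite Hcs; ring|].
        transitivity (c * (c * Y) + s * s * Y); [ring | rewrite G4; ring]. }
      assert (U : (c * X + s * Y - 1) * (c * X + s * Y + 1) = 0) by lra.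
      destruct (Rmult_integral _ _ U) as [U1|U1]; [left | right]; f_equal.
      * replace (c * X + s * Y) with 1 in EX by lra. unfold X in EX. lra.
      * replace (c * X + s * Y) with 1 in EY by lra. unfold Y in EY. lra.
      * replace (c * X + s * Y) with (-1) in EX by lra. unfold X in EX. lra.
      * replace (c * X + s * Y) with (-1) in EY by lra. unfold Y in EY. lra.
    + intros [G|G]; injection G; intros -> ->; split; ring.
  - intros [x y]. rewrite SP, !Rmult_0_l. split.
    + intros [G1 G2]. left.
      destruct (Rmult_integral _ _ G1) as [Z|Z]; rewrite Z in G2; f_equal; nra.
    + intros [G|G]; injection G; intros -> ->; split; ring.
  - simpl. lra.
  - unfold focal_invariant. simpl. ring.
  - simpl. lra.
  - unfold focal_invariant, b. cbn [b1 b2 b3 b4 b5 b6].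
    (* The terms in [p] and [q] cancel, as they only place the center, and the invariant equals
       1. *)
    replace (_ + _) with ((c * c + s * s) ^ 2) by ring. rewrite Hcs. lra.
  - unfold dist2. simpl. ring.
  - unfold dist2. simpl. ring.
Qed.

Theorem theorem1 : forall (D : point -> Prop) (V : R -> R -> R),
  open D -> connected_set D -> smooth_on D V ->
  ((exists K1 K2 : sym_tensor,
      killing K1 /\ killing K2 /\
      compatible D K1 V /\ compatible D K2 V /\
      invariant_conditions K1 K2)
   <-> is_smorodinsky_winternitz D V).
Proof.
  intros D V HD HC HV. split.
  - intros (K1 & K2 & _ & _ & H1 & H2 & H3).
    exact (compatible_pair_sw D V K1 K2 HD HC HV H1 H2 H3).
  - exact (sw_compatible_pair D V HD HV).
Qed.
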